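(* Let $A\in\mathbb{R}^{n\times n}$, $G\in\mathbb{R}^{n\times m}$, $C\in\mathbb{R}^{p\times n}$ and $H$ (with $p$ rows) be constant matrices with $A$ and $HH'$ invertible. Suppose that $(A,C)$ is observable and that $G$ is full-rank in the sense that $GG'$ is invertible. Define, for $P\in P_+(n)$, $$\Phi(P)=AP+PA'+GG'-PC'(HH')^{-1}CP .$$ Then there exists a unique $Q\in P_+(n)$ with $\Phi(Q)=0$. Moreover, for any $R\in P_+(n)$, let $$S_R=\{P\in P_+(n):\ d_{P_+(n)}(Q,P)\le d_{P_+(n)}(Q,R)\},$$ let $M_R=\sup\{\|P\|_2:\ P\in S_R\}$, and let $\mu>0$ be the lowest eigenvalue of $GG'$. Then $M_R<\infty$, and if $P_1(t),P_2(t)$ are two arbitrary solutions of $\frac{d}{dt}P=\Phi(P)$ initialized in $S_R$ at $t=0$, then $P_1(t),P_2(t)\in S_R$ for all $t\ge 0$ and $$d_{P_+(n)}(P_1(t),P_2(t))\le e^{-\frac{\mu}{M_R}t}\,d_{P_+(n)}(P_1(0),P_2(0))\qquad\text{for all } t\ge 0.$$ In particular, every solution $P(t)$ of $\frac{d}{dt}P=\Phi(P)$ with $P(0)\in P_+(n)$ tends exponentially to the stationary solution $Q$ for the distance $d_{P_+(n)}$.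
   Context: $M'$ denotes the transpose of $M$. $P_+(n)$ is the cone of symmetric positive definite $n\times n$ real matrices. $\|\cdot\|_2$ is the spectral norm. The natural Riemannian metric of $P_+(n)$ is $g_P(Y_1,Y_2)=\mathrm{Tr}(P^{-1}Y_1P^{-1}Y_2)$ for symmetric matrices $Y_1,Y_2$; its geodesic distance is $$d_{P_+(n)}(P,Q)=\Big\{\sum_{i=1}^n\log^2(\lambda_i)\Big\}^{1/2},$$ where $\lambda_1,\dots,\lambda_n$ are the eigenvalues of $PQ^{-1}$. The pair $(A,C)$ is observable if the matrix obtained by stacking $C,CA,\dots,CA^{n-1}$ has rank $n$. *)

(* Defs.v *)
From mathcomp Require Import all_boot all_order all_algebra.
From mathcomp Require Import all_classical all_reals all_analysis.

Set Implicit Arguments.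
Unset Strict Implicit.
Unset Printing Implicit Defensive.

Import Order.TTheory GRing.Theory Num.Theory.
Import numFieldNormedType.Exports.

Local Open Scope classical_set_scope.
Local Open Scope ring_scope.

Definition spd (R : realType) (n : nat) (P : 'M[R]_n) : Prop :=
  P^T = P /\ forall x : 'cV[R]_n, x != 0 -> 0 < (x^T *m P *m x) 0 0.

Definition enorm (R : realType) (n : nat) (x : 'cV[R]_n) : R :=
  Num.sqrt (\sum_(i < n) x i 0 ^+ 2).

Definition spectral_norm (R : realType) (m n : nat) (M : 'M[R]_(m, n)) : R :=
  sup [set enorm (M *m x) | x in [set x : 'cV[R]_n | enorm x <= 1]].

(* The roots of the characteristic polynomial of M, listed with multiplicity.
   The default value [::] is only taken when this polynomial does not split
   over R, which never happens for M = P Q^-1 with P and Q positive definite,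
   since M is then similar to the symmetric matrix Q^(-1/2) P Q^(-1/2). *)
Definition spectrum (R : realType) (n : nat) (M : 'M[R]_n) : seq R :=
  xget [::] [set s | char_poly M = \prod_(a <- s) ('X - a%:P)].

Definition spd_dist (R : realType) (n : nat) (P Q : 'M[R]_n) : R :=
  Num.sqrt (\sum_(a <- spectrum (P *m invmx Q)) ln a ^+ 2).

Definition spd_ball (R : realType) (n : nat) (Q R0 : 'M[R]_n) : set 'M[R]_n :=
  [set P | spd P /\ spd_dist Q P <= spd_dist Q R0].

Definition sup_norm_ball (R : realType) (n : nat) (Q R0 : 'M[R]_n) : \bar R :=
  ereal_sup [set (spectral_norm P)%:E | P in spd_ball Q R0].

Definition lowest_eigenvalue (R : realType) (n : nat) (M : 'M[R]_n) (mu : R) :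
    Prop :=
  eigenvalue M mu /\ forall a, eigenvalue M a -> mu <= a.

Definition observable (R : realType) (n p : nat)
    (A : 'M[R]_n) (C : 'M[R]_(p, n)) : Prop :=
  \rank (\mxcol_(i < n) (C *m A ^+ i)) = n.

Definition riccati (R : realType) (n m p q : nat) (A : 'M[R]_n)
    (G : 'M[R]_(n, m)) (C : 'M[R]_(p, n)) (H : 'M[R]_(p, q)) (P : 'M[R]_n) :
    'M[R]_n :=
  A *m P + P *m A^T + G *m G^T - P *m C^T *m invmx (H *m H^T) *m C *m P.

(* P solves dP/dt = F(P) on [0, T[, with T possibly +oo. At the endpoint 0 only
   right-continuity is required: when F is continuous, the equation then also
   holds there for the right derivative. *)
Definition solution (R : realType) (n : nat) (F : 'M[R]_n -> 'M[R]_n)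
    (T : \bar R) (P : R -> 'M[R]_n) : Prop :=
  [/\ (0 < T)%E, P t @[t --> 0^'+] --> P 0 &
      forall t : R, 0 < t -> (t%:E < T)%E -> is_derive t 1 P (F (P t))].

(* The values of P outside [0, T[ are irrelevant. *)
Definition maximal_solution (R : realType) (n : nat) (F : 'M[R]_n -> 'M[R]_n)
    (T : \bar R) (P : R -> 'M[R]_n) : Prop :=
  solution F T P /\
  forall (T' : \bar R) (P' : R -> 'M[R]_n), solution F T' P' ->
    (forall t : R, 0 <= t -> (t%:E < T)%E -> P' t = P t) -> (T' <= T)%E.

(* Main.v *)
(* With W = G G^T and S = C^T (H H^T)^-1 C, the inverse X = P^-1 turns the
   equation Phi P = 0 into X W X + A^T X + X A = S.  Newton's method (each step is a
   Lyapunov equation), started at a large multiple of the identity, decreases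
   to a positive semidefinite solution, and observability makes its kernel
   trivial; Q is its inverse.

   For two solutions write P2 = U U^T and P1 = U diag(d) U^T at a given time.
   The derivative of sum_i ln(d_i)^2 then only involves the derivatives of P1
   and P2 in the basis v_i = U^-T e_i, even when eigenvalues collide; as
   P1 v_i = d_i P2 v_i, the terms in A cancel and the one in S has a favourable
   sign, so that W >= mu and P1, P2 <= M_R give the rate 2 mu / M_R for the
   squared distance.  No geodesic convexity of balls is needed, and with
   P2 = Q the same computation shows that balls centred at Q are invariant.

   Global existence: the solution is P = X Y^-1, where (X, Y) solves the linear
   Hamiltonian system X' = A X + W Y, Y' = S X - A^T Y with Y(0) = 1.  As
   (Y^T X)' = Y^T W Y + X^T S X >= 0, Y stays invertible and P positive
   definite for all t >= 0. *)
Require Import Defs.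
From mathcomp Require Import all_boot all_order all_algebra.
From mathcomp Require Import all_classical all_reals all_analysis.
From mathcomp Require Import complex ring lra.
Import Order.TTheory GRing.Theory Num.Theory.
Import numFieldNormedType.Exports.
Local Open Scope classical_set_scope.
Local Open Scope ring_scope.

Set Implicit Arguments.
Unset Strict Implicit.
Unset Printing Implicit Defensive.

(** * Symmetric matrices and pencils *)

Section QuadraticForms.
Variable R : realType.

(** The distance is read off an unordered list of characteristic roots, and single roots need not be
    differentiable where they collide. So no root is ever followed in time: the sum of squared
    logarithms is expanded to second order at a fixed diagonal pair, with an error quadratic in a
    matrix that is differentiable even at collisions. Simultaneous diagonalisation by congruence
    ([simdiag]) replaces matrix square roots and the spectral theorem. Its generalised eigenvectors
    decide the sign of solutions of Lyapunov equations as well as the sign of each term of the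
    dissipation. The rate comes from one inequality c P <= W along both solutions, with c = mu /
    M_R, since c P <= c M_R = mu <= W. This presupposes that the ball is invariant, which is proved
    beforehand with c = 0. A solution is not assumed to stay symmetric or positive: both properties
    are inherited from the Hamiltonian flow through uniqueness. *)

Definition bf n (P : 'M[R]_n) (x y : 'cV[R]_n) : R := (x^T *m P *m y) 0 0.
Definition psd n (P : 'M[R]_n) : Prop := forall x, 0 <= bf P x x.

Lemma bf_tr n (P : 'M[R]_n) x y : bf P x y = bf P^T y x.
Proof.
rewrite /bf -[in LHS](trmxK (_ *m y)) mxE.
by rewrite !trmx_mul trmxK mulmxA.
Qed.

Lemma bf_sym n (P : 'M[R]_n) x y : P^T = P -> bf P x y = bf P y x.
Proof. by move=> Ps; rewrite bf_tr Ps. Qed.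

Lemma bfD n (P Q : 'M[R]_n) x y : bf (P + Q) x y = bf P x y + bf Q x y.
Proof. by rewrite /bf mulmxDr mulmxDl mxE. Qed.

Lemma bfN n (P : 'M[R]_n) x y : bf (- P) x y = - bf P x y.
Proof. by rewrite /bf mulmxN mulNmx mxE. Qed.

Lemma bfB n (P Q : 'M[R]_n) x y : bf (P - Q) x y = bf P x y - bf Q x y.
Proof. by rewrite bfD bfN. Qed.

Lemma bfZ n a (P : 'M[R]_n) x y : bf (a *: P) x y = a * bf P x y.
Proof. by rewrite /bf -scalemxAr -scalemxAl mxE. Qed.

Lemma bfDl n (P : 'M[R]_n) x y z : bf P (x + y) z = bf P x z + bf P y z.
Proof. by rewrite /bf linearD /= !mulmxDl mxE. Qed.

Lemma bfDr n (P : 'M[R]_n) x y z : bf P z (x + y) = bf P z x + bf P z y.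
Proof. by rewrite /bf mulmxDr mxE. Qed.

Lemma bfZl n a (P : 'M[R]_n) x z : bf P (a *: x) z = a * bf P x z.
Proof. by rewrite /bf linearZ /= -!scalemxAl mxE. Qed.

Lemma bfZr n a (P : 'M[R]_n) x z : bf P z (a *: x) = a * bf P z x.
Proof. by rewrite /bf -!scalemxAr mxE. Qed.

Lemma bf_congr n k (P : 'M[R]_n) (K : 'M[R]_(n, k)) x y :
  bf (K^T *m P *m K) x y = bf P (K *m x) (K *m y).
Proof. by rewrite /bf trmx_mul !mulmxA. Qed.

Lemma bf_mulmx n (P Q : 'M[R]_n) x y : bf (P *m Q) x y = bf P x (Q *m y).
Proof. by rewrite /bf !mulmxA. Qed.

Lemma bf_trmulmx n (P Q : 'M[R]_n) x y : bf (P^T *m Q) x y = bf Q (P *m x) y.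
Proof. by rewrite /bf trmx_mul !mulmxA. Qed.

Lemma bf1E n (x y : 'cV[R]_n) : bf 1%:M x y = \sum_i x i 0 * y i 0.
Proof. by rewrite /bf mulmx1 mxE; apply: eq_bigr => i _; rewrite mxE. Qed.

Lemma bf_diag n (d : 'rV[R]_n) (x : 'cV[R]_n) :
  bf (diag_mx d) x x = \sum_i d 0 i * x i 0 ^+ 2.
Proof.
rewrite /bf -mulmxA mxE; apply: eq_bigr => i _.
by rewrite mul_diag_mx !mxE; ring.
Qed.

Lemma bf_delta n (P : 'M[R]_n) i j :
  bf P (delta_mx i 0) (delta_mx j 0) = P i j.
Proof. by rewrite /bf trmx_delta -rowE -colE !mxE. Qed.

Lemma bf1_ge0 n (x : 'cV[R]_n) : 0 <= bf 1%:M x x.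
Proof. by rewrite bf1E sumr_ge0 // => i _; rewrite -expr2 sqr_ge0. Qed.

Lemma bf1_gt0 n (x : 'cV[R]_n) : x != 0 -> 0 < bf 1%:M x x.
Proof.
move=> x0; rewrite lt_neqAle bf1_ge0 andbT eq_sym bf1E.
apply: contraNneq x0 => /eqP; rewrite psumr_eq0 => [/allP h|i _]; last first.
  by rewrite -expr2 sqr_ge0.
apply/eqP/matrixP => i j; rewrite ord1 mxE.
by move/(_ i): h; rewrite mem_index_enum -expr2 sqrf_eq0 => /(_ isT)/eqP.
Qed.

Lemma spd1 n : spd (1%:M : 'M[R]_n).
Proof. by split; [rewrite trmx1 | move=> x /bf1_gt0]. Qed.

Lemma spd_psd n (P : 'M[R]_n) : spd P -> psd P.
Proof.
move=> [_ h] x; have [->|x0] := eqVneq x 0; last exact/ltW/h.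
by rewrite /bf mulmx0 mxE.
Qed.

Lemma spd_unit n (P : 'M[R]_n) : spd P -> P \in unitmx.
Proof.
move=> [Ps P0]; rewrite unitmxE unitfE; apply/negP => /det0P[v v0 vP].
have v0' : v^T != 0 by rewrite -trmx0 (inj_eq trmx_inj).
by have := P0 _ v0'; rewrite trmxK vP mul0mx mxE ltxx.
Qed.

Lemma sym_inv n (P : 'M[R]_n) : P^T = P -> (invmx P)^T = invmx P.
Proof. by move=> Ps; rewrite trmx_inv Ps. Qed.

Lemma unitmx_inj0 n (P : 'M[R]_n) (x : 'cV[R]_n) :
  P \in unitmx -> P *m x = 0 -> x = 0.
Proof. by move=> Pu h; rewrite -(mulKmx Pu x) h mulmx0. Qed.

Lemma spd_congr n k (P : 'M[R]_n) (K : 'M[R]_(n, k)) :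
  spd P -> (forall x : 'cV[R]_k, K *m x = 0 -> x = 0) -> spd (K^T *m P *m K).
Proof.
move=> [Ps P0] Ki; split; first by rewrite !trmx_mul trmxK Ps mulmxA.
move=> x x0; rewrite -/(bf _ x x) bf_congr; apply: P0.
by apply: contra_neq x0; apply: Ki.
Qed.

Lemma psd_congr n k (P : 'M[R]_n) (K : 'M[R]_(n, k)) :
  psd P -> psd (K^T *m P *m K).
Proof. by move=> P0 x; rewrite bf_congr. Qed.

Lemma spd_inv n (P : 'M[R]_n) : spd P -> spd (invmx P).
Proof.
move=> Ppd; have Pu := spd_unit Ppd; have [Ps _] := Ppd.
have -> : invmx P = (invmx P)^T *m P *m invmx P.
  by rewrite sym_inv // mulVmx // mul1mx.
by apply: spd_congr => // x; apply: unitmx_inj0; rewrite unitmx_inv.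
Qed.

Lemma psdD n (P Q : 'M[R]_n) : psd P -> psd Q -> psd (P + Q).
Proof. by move=> p q x; rewrite bfD addr_ge0. Qed.

Lemma spd_psdD n (P Q : 'M[R]_n) : spd P -> Q^T = Q -> psd Q -> spd (P + Q).
Proof.
move=> [Ps p] Qs q; split; first by rewrite linearD /= Ps Qs.
by move=> x x0; rewrite -/(bf _ _ _) bfD ltr_pwDl ?p ?q.
Qed.

Lemma psdZ n a (P : 'M[R]_n) : 0 <= a -> psd P -> psd (a *: P).
Proof. by move=> a0 p x; rewrite bfZ mulr_ge0. Qed.

Lemma spdZ n a (P : 'M[R]_n) : 0 < a -> spd P -> spd (a *: P).
Proof.
move=> a0 [Ps p]; split; first by rewrite linearZ /= Ps.
by move=> x x0; rewrite -/(bf _ _ _) bfZ mulr_gt0 ?p.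
Qed.

Lemma spd_mulmxT n m (G : 'M[R]_(n, m)) :
  G *m G^T \in unitmx -> spd (G *m G^T).
Proof.
move=> u; rewrite -[X in X *m _]trmxK -[G^T^T]mulmx1.
apply: spd_congr; first exact: spd1.
by move=> x Gx; apply: (unitmx_inj0 u); rewrite -mulmxA Gx mulmx0.
Qed.

(* The test vector is a real or imaginary part of a complex eigenvector of
   P Q^-1, whose eigenvalue is forced to be real by the symmetry of P and Q. *)
Lemma pencil_eigenvector n (P Q : 'M[R]_n.+1) : P^T = P -> spd Q ->
  exists (v : 'cV[R]_n.+1) (a : R), v != 0 /\ P *m v = a *: (Q *m v).
Proof.
move=> Ps Qpd; have Qu := spd_unit Qpd; have [Qs Q0] := Qpd.
pose toC := real_complex R.
have [c] : exists c, root (char_poly (map_mx toC (P *m invmx Q))) c.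
  by apply/closed_rootP; rewrite size_char_poly.
rewrite -eigenvalue_root_char => /eigenvalueP[z zE z0].
pose x := map_mx (@complex.Re R) z; pose y := map_mx (@complex.Im R) z.
have zxy : z = map_mx toC x + ('i)%C *: map_mx toC y.
  by apply/matrixP => i j; rewrite !mxE -complexE.
have {zE} : z *m map_mx toC P = c *: (z *m map_mx toC Q).
  by rewrite scalemxAl -zE -mulmxA -map_mxM /= mulmxKV.
case: c => a b.
rewrite zxy !mulmxDl -!scalemxAl -!map_mxM => /matrixP zE.
have xE : x *m P = a *: (x *m Q) - b *: (y *m Q).
  apply/matrixP => i j; have := zE i j; rewrite !mxE.
  move: (\sum__ _) (\sum__ _) (\sum__ _) (\sum__ _) => p1 p2 p3 p4.
  by move/eqP; rewrite eq_complex /= => /andP[/eqP h _]; lra.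
have yE : y *m P = a *: (y *m Q) + b *: (x *m Q).
  apply/matrixP => i j; have := zE i j; rewrite !mxE.
  move: (\sum__ _) (\sum__ _) (\sum__ _) (\sum__ _) => p1 p2 p3 p4.
  by move/eqP; rewrite eq_complex /= => /andP[_ /eqP h]; lra.
have xyP : bf P x^T y^T = bf P y^T x^T by exact: bf_sym.
have xQy : bf Q x^T y^T = bf Q y^T x^T by exact: bf_sym.
(* Evaluating x P y^T through each of the two eigenvector equations gives values that differ by this
   quantity. *)
have b0 : b * (bf Q x^T x^T + bf Q y^T y^T) = 0.
  move: xyP xQy; rewrite /bf !trmxK xE yE !mulmxBl !mulmxDl -!scalemxAl !mxE.
  by move=> h1 h2; nra.
have [x0|x0] := eqVneq x 0.
  have y0 : y^T != 0.
    rewrite -trmx0 (inj_eq trmx_inj); apply: contra_neq z0 => y0.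
    by rewrite zxy x0 y0 !map_mx0 scaler0 addr0.
  exists y^T, a; split => //.
  by rewrite -{1}Ps -{1}Qs -!trmx_mul yE x0 mul0mx scaler0 addr0 linearZ.
have x0' : x^T != 0 by rewrite -trmx0 (inj_eq trmx_inj).
exists x^T, a; split => //.
have := Q0 _ x0'; rewrite -/(bf _ _ _) => xQ0.
have b00 : b = 0.
  move/eqP: b0; rewrite mulf_eq0 => /orP[/eqP//|/eqP h].
  by have := spd_psd Qpd y^T; move: h xQ0 => /= ; lra.
by rewrite -{1}Ps -{1}Qs -!trmx_mul xE b00 scale0r subr0 linearZ.
Qed.

(** Deflation for [simdiag_congr]: the columns of N form a basis of the orthogonal complement of
    w. *)
Lemma kernel_basis n (w : 'cV[R]_n.+1) : w != 0 ->
  exists N : 'M[R]_(n.+1, n),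
    N^T *m w = 0 /\ forall x : 'cV[R]_n, N *m x = 0 -> x = 0.
Proof.
move=> w0.
have rk : \rank (kermx w) = n.
  rewrite mxrank_ker; suff -> : \rank w = 1%N by rewrite subn1.
  by apply/eqP; rewrite eqn_leq rank_leq_col lt0n mxrank_eq0.
have [N Nfree Nw] : exists2 N : 'M[R]_(n, n.+1), row_free N & N *m w = 0.
  have := row_base_free (kermx w).
  have : row_base (kermx w) *m w = 0.
    by apply/sub_kermxP; rewrite eq_row_base.
  move: (row_base (kermx w)); rewrite rk => N; by exists N.
exists N^T; split; first by rewrite trmxK.
move=> x Nx; apply: trmx_inj; rewrite trmx0.
by apply: (row_free_inj Nfree); rewrite mul0mx -[N]trmxK -trmx_mul Nx trmx0.
Qed.

(** Induction on the size. If P v = a Q v, the complement of Q v is orthogonal to v for both forms,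
    so restricting P and Q to it splits off v, normalised by Q. *)
Lemma simdiag_congr n (P Q : 'M[R]_n) : P^T = P -> spd Q ->
  exists (V : 'M[R]_n) (d : 'rV[R]_n),
    V^T *m Q *m V = 1%:M /\ V^T *m P *m V = diag_mx d.
Proof.
elim: n P Q => [P Q _ _|n IH P Q Ps Qpd].
  by exists 0, 0; split; apply/matrixP => -[].
have [Qs Q0] := Qpd.
have [v1 [a [v10 Pv1]]] := pencil_eigenvector Ps Qpd.
pose c := Num.sqrt (bf Q v1 v1); have c0 : 0 < c by rewrite sqrtr_gt0 Q0.
pose v := c^-1 *: v1.
have Pv : P *m v = a *: (Q *m v) by rewrite -!scalemxAr Pv1 !scalerA mulrC.
have vQv : v^T *m Q *m v = 1%:M.
  apply/matrixP => i j; rewrite !ord1 -/(bf _ _ _) bfZl bfZr mulrA -expr2.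
  rewrite -[X in _ * X]sqr_sqrtr ?ltW ?Q0 // -/c -exprMn mulVf ?gt_eqF //.
  by rewrite expr1n mxE.
have v0 : v != 0 by rewrite scaler_eq0 invr_eq0 gt_eqF.
have w0 : Q *m v != 0.
  by apply: contra_neq v0 => h; rewrite (unitmx_inj0 (spd_unit Qpd) h).
have [N [Nw Ni]] := kernel_basis w0.
have Q1 : spd (N^T *m Q *m N) by apply: spd_congr.
have P1 : (N^T *m P *m N)^T = N^T *m P *m N by rewrite !trmx_mul trmxK Ps mulmxA.
have [V [d [VQ VP]]] := IH _ _ P1 Q1.
have NQv : N^T *m Q *m v = 0 by rewrite -mulmxA.
have NPv : N^T *m P *m v = 0 by rewrite -mulmxA Pv -scalemxAr mulmxA NQv scaler0.
have vQN : v^T *m Q *m N = 0.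
  by apply: trmx_inj; rewrite !trmx_mul trmxK Qs mulmxA NQv trmx0.
have vPN : v^T *m P *m N = 0.
  by apply: trmx_inj; rewrite !trmx_mul trmxK Ps mulmxA NPv trmx0.
have vPv : v^T *m P *m v = a%:M.
  by rewrite -mulmxA Pv -scalemxAr mulmxA vQv scalemx1.
pose W : 'M[R]_(n.+1, 1 + n) := row_mx v (N *m V).
pose e : 'rV[R]_(1 + n) := row_mx a%:M d.
have WQ : W^T *m Q *m W = 1%:M.
  rewrite tr_row_mx mul_col_mx mul_col_row trmx_mul vQv.
  have -> : v^T *m Q *m (N *m V) = 0 by rewrite mulmxA vQN mul0mx.
  have -> : V^T *m N^T *m Q *m v = 0 by rewrite -2!mulmxA (mulmxA N^T) NQv mulmx0.
  have -> : V^T *m N^T *m Q *m (N *m V) = 1%:M by rewrite -VQ !mulmxA.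
  by rewrite -scalar_mx_block.
suff WP : W^T *m P *m W = diag_mx e by exists W, e.
rewrite tr_row_mx mul_col_mx mul_col_row trmx_mul vPv.
  have -> : v^T *m P *m (N *m V) = 0 by rewrite mulmxA vPN mul0mx.
have -> : V^T *m N^T *m P *m v = 0 by rewrite -2!mulmxA (mulmxA N^T) NPv mulmx0.
have -> : V^T *m N^T *m P *m (N *m V) = diag_mx d by rewrite -VP !mulmxA.
rewrite diag_mx_row; congr block_mx.
by apply/matrixP => i j; rewrite !ord1 !mxE eqxx.
Qed.

(** The inverse transpose of the previous basis. With Q = 1, U is orthogonal and this is the
    spectral theorem for P. *)
Lemma simdiag n (P Q : 'M[R]_n) : P^T = P -> spd Q ->
  exists (U : 'M[R]_n) (d : 'rV[R]_n),
    [/\ U \in unitmx, Q = U *m U^T & P = U *m diag_mx d *m U^T].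
Proof.
move=> Ps Qpd; have [V [d [VQ VP]]] := simdiag_congr Ps Qpd.
have Vu : V \in unitmx by case/mulmx1_unit: VQ.
have VTu : V^T \in unitmx by rewrite unitmx_tr.
exists (invmx V^T), d; split; first by rewrite unitmx_inv.
  by rewrite trmx_inv trmxK -[invmx V^T]mulmx1 -VQ !mulmxA mulVmx // mul1mx mulmxK.
by rewrite trmx_inv trmxK -VP !mulmxA mulVmx // mul1mx mulmxK.
Qed.


Lemma bf_gram n m (U : 'M[R]_(n, m)) x y :
  bf (U *m U^T) x y = bf 1%:M (U^T *m x) (U^T *m y).
Proof. by rewrite -bf_congr trmxK mulmx1. Qed.

(** The columns of U^-T are the generalised eigenvectors of the pair, normalised for the second
    form. They are the test vectors of the Lyapunov, uniqueness and contraction arguments. *)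
Lemma pencil_vector n (U : 'M[R]_n) (d : 'rV[R]_n) (i : 'I_n) :
    U \in unitmx ->
  let v := invmx U^T *m delta_mx i 0 : 'cV[R]_n in
  [/\ U *m diag_mx d *m U^T *m v = d 0 i *: (U *m U^T *m v),
      bf (U *m U^T) v v = 1 & v != 0].
Proof.
move=> Uu v; have UTu : U^T \in unitmx by rewrite unitmx_tr.
have Uv : U^T *m v = delta_mx i 0 by rewrite mulKVmx.
have v0 : v != 0.
  apply: contra_eq_neq Uv => ->; rewrite mulmx0 eq_sym.
  by apply/negP => /eqP/matrixP/(_ i 0)/eqP; rewrite !mxE !eqxx oner_eq0.
split=> //; first rewrite -!mulmxA Uv scalemxAr; first congr mulmx.
  apply/matrixP => j k; rewrite mul_diag_mx !mxE; case: eqP => [->//|_].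
  by rewrite !mulr0.
by rewrite bf_gram Uv bf_delta mxE eqxx.
Qed.

Lemma pencil_psd n (U : 'M[R]_n) (d : 'rV[R]_n) (x : 'cV[R]_n) :
  bf (U *m diag_mx d *m U^T) x x = \sum_i d 0 i * (U^T *m x) i 0 ^+ 2.
Proof. by rewrite -bf_diag -bf_congr trmxK. Qed.

Lemma pencil_base n (U : 'M[R]_n) (x : 'cV[R]_n) :
  bf (U *m U^T) x x = \sum_i (U^T *m x) i 0 ^+ 2.
Proof.
rewrite bf_gram bf1E.
by apply: eq_bigr => i _; rewrite expr2.
Qed.

Lemma pencil_spd n (U : 'M[R]_n) (d : 'rV[R]_n) : U \in unitmx ->
  spd (U *m diag_mx d *m U^T) -> forall i, 0 < d 0 i.
Proof.
move=> Uu [_ p] i; have [vE v1 v0] := pencil_vector d i Uu.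
have := p _ v0; rewrite -/(bf _ _ _).
by rewrite /bf -mulmxA vE -scalemxAr mxE mulmxA -/(bf _ _ _) v1 mulr1.
Qed.

Lemma psd_ker n (P : 'M[R]_n) x : P^T = P -> psd P -> bf P x x = 0 -> P *m x = 0.
Proof.
move=> Ps P0 Px; have [U [d [Uu _ PE]]] := simdiag Ps (spd1 n).
have d0 i : 0 <= d 0 i.
  have [vE v1 v0] := pencil_vector d i Uu.
  have := P0 (invmx U^T *m delta_mx i 0).
  by rewrite PE /bf -mulmxA vE -scalemxAr mxE mulmxA -/(bf _ _ _) v1 mulr1.
move: Px; rewrite PE pencil_psd => /eqP; rewrite psumr_eq0 => [/allP h|i _].
  rewrite -!mulmxA -[RHS](mulmx0 _ U); congr mulmx; apply/matrixP => i j.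
  rewrite ord1 mul_diag_mx !mxE; have := h i; rewrite mem_index_enum => /(_ isT).
  by rewrite /= mulf_eq0 sqrf_eq0 -/(_ *m _) mxE => /orP[]/eqP ->; rewrite ?mul0r ?mulr0.
by rewrite mulr_ge0 // sqr_ge0.
Qed.

Lemma psd_entry n (P : 'M[R]_n) i j : P^T = P -> psd P ->
  `|P i j| <= (P i i + P j j) / 2.
Proof.
move=> Ps P0; have Pji : P j i = P i j by rewrite -[in LHS]Ps mxE.
have := P0 (delta_mx i 0 + delta_mx j 0); have := P0 (delta_mx i 0 - delta_mx j 0).
rewrite -scaleN1r !(bfDl, bfDr, bfZl, bfZr) !bf_delta Pji => h1 h2.
by rewrite ler_norml; apply/andP; split; lra.
Qed.

Lemma spd_lower n (P : 'M[R]_n) : spd P ->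
  exists2 e, 0 < e & forall x, e * bf 1%:M x x <= bf P x x.
Proof.
move=> Ppd; have [U [d [Uu E1 PE]]] := simdiag (proj1 Ppd) (spd1 n).
have d0 := pencil_spd Uu (eq_ind _ (@spd R n) Ppd _ PE).
(* Only 0 < e <= d_i matters; the neutral value 1 also covers n = 0. *)
exists (\big[Order.min/1]_i d 0 i).
  by apply: (big_ind (fun y => 0 < y)) => // a b a0 b0; rewrite lt_min a0.
move=> x; rewrite PE E1 pencil_psd pencil_base mulr_sumr; apply: ler_sum => i _.
by rewrite ler_wpM2r ?sqr_ge0 // (bigD1 i) //= ge_min lexx.
Qed.

Lemma bf_upper n (P : 'M[R]_n) : P^T = P ->
  exists2 e, 0 <= e & forall x, `|bf P x x| <= e * bf 1%:M x x.
Proof.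
move=> Ps; have [U [d [Uu E1 PE]]] := simdiag Ps (spd1 n).
exists (\sum_i `|d 0 i|); first exact: sumr_ge0.
move=> x; rewrite PE E1 pencil_psd pencil_base mulr_sumr.
apply: le_trans (ler_norm_sum _ _ _) _; apply: ler_sum => i _.
rewrite normrM [`|_ ^+ 2|]ger0_norm ?sqr_ge0 // ler_wpM2r ?sqr_ge0 //.
by rewrite (bigD1 i) //= lerDl sumr_ge0.
Qed.

Lemma lowest_eigenvalue_spd n (W : 'M[R]_n) : (0 < n)%N -> spd W ->
  exists mu, [/\ lowest_eigenvalue W mu, 0 < mu &
    forall x, mu * bf 1%:M x x <= bf W x x].
Proof.
case: n W => // n W _ Wpd; have Ws := proj1 Wpd.
have [U [d [Uu E1 WE]]] := simdiag Ws (spd1 n.+1).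
have d0 := pencil_spd Uu (eq_ind _ (@spd R n.+1) Wpd _ WE).
have [k _ kP] := arg_minP (fun i => d 0 i) (isT : xpredT (ord0 : 'I_n.+1)).
have lb x : d 0 k * bf 1%:M x x <= bf W x x.
  rewrite WE E1 pencil_psd pencil_base mulr_sumr; apply: ler_sum => i _.
  by rewrite ler_wpM2r ?sqr_ge0 // kP.
exists (d 0 k); split => //; split.
  have [vE v1 v0] := pencil_vector d k Uu.
  (* [eigenvalue] refers to row vectors, so the eigenvector is transposed and the symmetry of W is
     used. *)
  apply/eigenvalueP; exists (invmx U^T *m delta_mx k 0)^T.
    by rewrite -[in LHS]Ws -trmx_mul WE vE -E1 mul1mx linearZ.
  by rewrite -trmx0 (inj_eq trmx_inj).
move=> a /eigenvalueP[v vE v0].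
have v0' : v^T != 0 by rewrite -trmx0 (inj_eq trmx_inj).
have vW : bf W v^T v^T = a * bf 1%:M v^T v^T.
  by rewrite /bf trmxK vE -scalemxAl mulmx1 mxE.
by have := lb v^T; rewrite vW ler_pM2r ?bf1_gt0.
Qed.

End QuadraticForms.

(** * Entrywise limits of matrices *)

Section EntrywiseConvergence.
Context (R : realType) (T : Type) (F : set_system T) {FF : Filter F}.

Definition mcvg m n (X : T -> 'M[R]_(m, n)) (L : 'M[R]_(m, n)) : Prop :=
  forall i j, X t i j @[t --> F] --> L i j.

Lemma cvg_bigsum (I : Type) (r : seq I) (f : I -> T -> R) (l : I -> R) :
  (forall i, f i @ F --> l i) ->
  \sum_(i <- r) f i t @[t --> F] --> \sum_(i <- r) l i.
Proof.
move=> fl; elim: r => [|i r IH].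
  by rewrite big_nil; under eq_fun do rewrite big_nil; exact: cvg_cst.
rewrite big_cons; under eq_fun do rewrite big_cons.
exact: cvgD (fl i) IH.
Qed.

Lemma cvg_bigprod (I : Type) (r : seq I) (f : I -> T -> R) (l : I -> R) :
  (forall i, f i @ F --> l i) ->
  \prod_(i <- r) f i t @[t --> F] --> \prod_(i <- r) l i.
Proof.
move=> fl; elim: r => [|i r IH].
  by rewrite big_nil; under eq_fun do rewrite big_nil; exact: cvg_cst.
rewrite big_cons; under eq_fun do rewrite big_cons.
exact: cvgM (fl i) IH.
Qed.

Lemma mcvg_eq m n (X Y : T -> 'M[R]_(m, n)) L :
  X =1 Y -> mcvg Y L -> mcvg X L.
Proof. by move=> /funext ->. Qed.

Lemma mcvg_cst m n (L : 'M[R]_(m, n)) : mcvg (fun=> L) L.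
Proof. by move=> i j; exact: cvg_cst. Qed.

Lemma mcvgD m n (X Y : T -> 'M[R]_(m, n)) L M :
  mcvg X L -> mcvg Y M -> mcvg (fun t => X t + Y t) (L + M).
Proof.
move=> XL YM i j; rewrite mxE; under eq_fun do rewrite mxE.
exact: cvgD (XL i j) (YM i j).
Qed.

Lemma mcvgN m n (X : T -> 'M[R]_(m, n)) L :
  mcvg X L -> mcvg (fun t => - X t) (- L).
Proof.
by move=> XL i j; rewrite mxE; under eq_fun do rewrite mxE; exact: cvgN (XL i j).
Qed.

Lemma mcvgB m n (X Y : T -> 'M[R]_(m, n)) L M :
  mcvg X L -> mcvg Y M -> mcvg (fun t => X t - Y t) (L - M).
Proof. by move=> XL YM; exact: mcvgD XL (mcvgN YM). Qed.

Lemma mcvgM m n p (X : T -> 'M[R]_(m, n)) (Y : T -> 'M[R]_(n, p)) L M :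
  mcvg X L -> mcvg Y M -> mcvg (fun t => X t *m Y t) (L *m M).
Proof.
move=> XL YM i j; rewrite mxE; under eq_fun do rewrite mxE.
by apply: cvg_bigsum => k; exact: cvgM (XL i k) (YM k j).
Qed.

Lemma mcvg_tr m n (X : T -> 'M[R]_(m, n)) L :
  mcvg X L -> mcvg (fun t => (X t)^T) L^T.
Proof. by move=> XL i j; rewrite mxE; under eq_fun do rewrite mxE; exact: XL. Qed.

Lemma cvg_det n (X : T -> 'M[R]_n) L :
  mcvg X L -> \det (X t) @[t --> F] --> \det L.
Proof.
move=> XL; rewrite /determinant; apply: cvg_bigsum => s.
apply: cvgM; first exact: cvg_cst.
by apply: cvg_bigprod => i; exact: XL.
Qed.

Lemma near_unitmx n (X : T -> 'M[R]_n) L :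
  L \in unitmx -> mcvg X L -> \forall t \near F, X t \in unitmx.
Proof.
move=> Lu XL; have dL : \det L != 0 by rewrite -unitfE -unitmxE.
have := cvg_det XL; move/cvgrPdist_lt => /(_ `|\det L|).
rewrite normr_gt0 => /(_ dL); apply: filterS => t.
rewrite unitmxE unitfE.
by apply: contraTneq => ->; rewrite subr0 ltxx.
Qed.

(** Cramer's formula: the adjugate and the determinant are polynomial in the entries. [invmx]
    follows this formula only on invertible matrices, hence the recourse to [near_unitmx]. *)
Lemma mcvg_inv n (X : T -> 'M[R]_n) L : L \in unitmx ->
  mcvg X L -> mcvg (fun t => invmx (X t)) (invmx L).
Proof.
move=> Lu XL; have Xu := near_unitmx Lu XL.
have adjE i j : \adj (X t) i j @[t --> F] --> \adj L i j.
  rewrite mxE; under eq_fun do rewrite mxE.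
  apply: cvgM; first exact: cvg_cst.
  apply: cvg_det => k l; rewrite !mxE; under eq_fun do rewrite !mxE.
  exact: XL.
move=> i j.
have -> : invmx L i j = (\det L)^-1 * \adj L i j by rewrite /invmx Lu mxE.
apply: cvg_trans (_ : (\det (X t))^-1 * \adj (X t) i j @[t --> F] --> _).
  apply: near_eq_cvg; near=> t.
  by rewrite /invmx ifT ?mxE //; near: t.
by apply: cvgM (adjE i j); apply: cvgV; [rewrite -unitfE -unitmxE|exact: cvg_det].
Unshelve. all: by end_near. Qed.

Lemma cvg_bf n (X : T -> 'M[R]_n) L x y :
  mcvg X L -> bf (X t) x y @[t --> F] --> bf L x y.
Proof.
move=> XL.
have h : mcvg (fun t => x^T *m X t *m y) (x^T *m L *m y).
  by apply: mcvgM; [apply: mcvgM => //; exact: mcvg_cst | exact: mcvg_cst].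
exact: h.
Qed.

Lemma mcvg_unique m n (X : T -> 'M[R]_(m, n)) L M {PF : ProperFilter F} :
  mcvg X L -> mcvg X M -> L = M.
Proof.
move=> XL XM; apply/matrixP => i j.
exact: (cvg_unique _ (XL i j) (XM i j)).
Qed.

End EntrywiseConvergence.

(** * The algebraic Riccati equation *)

Section AlgebraicRiccati.
Variable R : realType.

Lemma spd_diag n (d : 'rV[R]_n) : (forall i, 0 < d 0 i) -> spd (diag_mx d).
Proof.
move=> d0; split; first exact: tr_diag_mx.
move=> x x0; rewrite -/(bf _ _ _) bf_diag lt_neqAle andbC.
rewrite sumr_ge0 => [|i _]; last by rewrite mulr_ge0 ?sqr_ge0 // ltW.
rewrite eq_sym; apply: contraNneq x0 => /eqP.
rewrite psumr_eq0 => [/allP h|i _]; last by rewrite mulr_ge0 ?sqr_ge0 // ltW.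
apply/eqP/matrixP => i j; rewrite ord1 mxE; have := h i.
rewrite mem_index_enum => /(_ isT).
by rewrite /= mulf_eq0 gt_eqF //= sqrf_eq0 => /eqP.
Qed.

(** Where X v = d Y v, the value of A^T X + X A at v is 2 (A v)^T X v = 2 d (A v)^T Y v. Each d_i is
    thus a ratio of values of the two Lyapunov right-hand sides, and its sign is known without an
    integral formula for X. *)
Lemma lyap_eigen n (A Y X : 'M[R]_n) : X^T = X -> spd Y ->
  exists (U : 'M[R]_n) (d : 'rV[R]_n),
    [/\ U \in unitmx, Y = U *m U^T, X = U *m diag_mx d *m U^T &
    forall i, exists2 v : 'cV[R]_n, v != 0 &
      bf (A^T *m X + X *m A) v v = d 0 i * bf (A^T *m Y + Y *m A) v v].
Proof.
move=> Xs Ypd; have [Ys _] := Ypd.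
have [U [d [Uu YE XE]]] := simdiag Xs Ypd.
exists U, d; split => // i; have [vE _ v0] := pencil_vector d i Uu.
exists (invmx U^T *m delta_mx i 0) => //; move: vE.
rewrite -YE -XE; move: (invmx _ *m _) => v vE.
rewrite !bfD !bf_trmulmx !bf_mulmx bf_sym // [in RHS](bf_sym _ _ Ys).
by rewrite (bf_sym _ _ Xs) (bf_sym _ _ Ys) /bf -!mulmxA vE;
   rewrite -!scalemxAr !mxE; ring.
Qed.

Lemma lyap_psd n (A Y X : 'M[R]_n) : spd Y -> spd (A^T *m Y + Y *m A) ->
  X^T = X -> psd (A^T *m X + X *m A) -> psd X.
Proof.
move=> Ypd [_ B0] Xs Wp; have [U [d [Uu _ XE dv]]] := lyap_eigen A Xs Ypd.
move=> x; rewrite XE pencil_psd sumr_ge0 // => i _.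
have [v /B0 Bv vE] := dv i; have := Wp v; rewrite vE pmulr_lge0 // => d0.
by rewrite mulr_ge0 // sqr_ge0.
Qed.

Lemma lyap_spd n (A Y X : 'M[R]_n) : spd Y -> spd (A^T *m Y + Y *m A) ->
  X^T = X -> spd (A^T *m X + X *m A) -> spd X.
Proof.
move=> Ypd Bpd Xs Wpd; have [U [d [Uu _ XE dv]]] := lyap_eigen A Xs Ypd.
rewrite XE -[X in X *m _ *m _]trmxK; apply: spd_congr.
  apply: spd_diag => i; have [v v0 vE] := dv i.
  by have := proj2 Wpd _ v0; rewrite -/(bf _ _ _) vE pmulr_lgt0 // (proj2 Bpd).
by move=> x; apply: unitmx_inj0; rewrite unitmx_tr.
Qed.

(** Solvability follows from injectivity by dimension. A symmetric X in the kernel is semidefinite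
    together with its opposite, by [lyap_psd], hence zero. *)
Lemma lyap_solve n (A Y W : 'M[R]_n) : spd Y -> spd (A^T *m Y + Y *m A) ->
  W^T = W -> exists2 X, X^T = X & A^T *m X + X *m A = W.
Proof.
move=> Ypd Bpd Ws.
(* Twice the Lyapunov operator on the symmetric part of X, plus twice the antisymmetric part. The
   two images are respectively symmetric and antisymmetric, so they do not interact, and L is an
   endomorphism of all square matrices whose injectivity gives an invertible [LM]. *)
pose L (X : 'M[R]_n) := (A^T *m (X + X^T) + (X + X^T) *m A) + (X - X^T).
have symD (X : 'M[R]_n) : (X + X^T)^T = X + X^T by rewrite linearD /= trmxK addrC.
have LT (X : 'M[R]_n) : (A^T *m (X + X^T) + (X + X^T) *m A)^T
    = A^T *m (X + X^T) + (X + X^T) *m A.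
  by rewrite linearD /= !trmx_mul trmxK symD addrC.
pose T := lin_mx (@trmx R n n).
pose LM := (1%:M + T) *m (lin_mulmx A^T + lin_mulmxr A) + (1%:M - T).
have LME X : mxvec X *m LM = mxvec (L X).
  rewrite mulmxDr mulmxA mulmxBr mulmxDr mulmx1 mul_vec_lin /=.
  have -> : mxvec X + mxvec X^T = mxvec (X + X^T) by rewrite linearD.
  have -> : mxvec X - mxvec X^T = mxvec (X - X^T) by rewrite linearB.
  by rewrite mulmxDr !mul_vec_lin -!linearD.
have sym_part (X V : 'M[R]_n) : V^T = V -> L X = V ->
    A^T *m (X + X^T) + (X + X^T) *m A = V /\ X = X^T.
  rewrite /L; move: (LT X); move: (_ + _ *m A) => Z Zs Vs ZV.
  have ZV' : Z - (X - X^T) = V.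
    apply/matrixP => i j; move/matrixP/(_ j i): ZV.
    by move/matrixP/(_ i j): Zs; move/matrixP/(_ i j): Vs; rewrite !mxE; lra.
  have X0 : X - X^T = 0.
    apply/matrixP => i j; move/matrixP/(_ i j): ZV; move/matrixP/(_ i j): ZV'.
    by rewrite !mxE => h1 h2; lra.
  by split; [rewrite -ZV X0 addr0 | apply/eqP; rewrite -subr_eq0 X0].
have Linj X : L X = 0 -> X = 0.
  move=> /(sym_part _ _ (trmx0 _ _ _)) [h XT].
  have psd0 (Z : 'M[R]_n) : Z = 0 -> psd Z.
    by move=> -> x; rewrite /bf mulmx0 mul0mx mxE.
  have p1 := lyap_psd Ypd Bpd (symD X) (psd0 _ h).
  have p2 : psd (- (X + X^T)).
    apply: (lyap_psd Ypd Bpd); first by rewrite linearN /= symD.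
    by apply: psd0; rewrite mulmxN mulNmx -opprD h oppr0.
  have S0 : X + X^T = 0.
    have h3 (x : 'cV[R]_n) : (X + X^T) *m x = 0.
      apply: psd_ker => //; apply/eqP; rewrite eq_le p1 andbT.
      by have := p2 x; rewrite bfN oppr_ge0.
    apply/matrixP => i j.
    by have /matrixP/(_ i 0) := h3 (delta_mx j 0); rewrite -colE !mxE.
  apply/matrixP => i j; move/matrixP/(_ i j): S0; rewrite -XT !mxE.
  by lra.
have Lu : LM \in unitmx.
  rewrite -row_free_unit -kermx_eq0; apply/eqP/row_matrixP => i; rewrite row0.
  have : row i (kermx LM) *m LM = 0 by rewrite -row_mul mulmx_ker row0.
  rewrite -[row i _]vec_mxK LME => h.
  rewrite (Linj (vec_mx (row i (kermx LM)))) ?linear0 //.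
  by apply: (can_inj mxvecK); rewrite h linear0.
pose X := vec_mx (mxvec W *m invmx LM).
have LX : L X = W by apply: (can_inj mxvecK); rewrite -LME vec_mxK mulmxKV.
have [h _] := sym_part _ _ Ws LX.
by exists (X + X^T).
Qed.
End AlgebraicRiccati.

Section MatrixExpansion.
Variable R : realType.

Lemma addmxE m n (A B : 'M[R]_(m, n)) i j : (A + B) i j = A i j + B i j.
Proof. exact: mxE. Qed.

Lemma oppmxE m n (A : 'M[R]_(m, n)) i j : (- A) i j = - A i j.
Proof. exact: mxE. Qed.

Lemma scalemxE m n a (A : 'M[R]_(m, n)) i j : (a *: A) i j = a * A i j.
Proof. exact: mxE. Qed.

Definition mxexpand := (mulmxDl, mulmxDr, mulmxBl, mulmxBr, mulmxN, mulNmx, mulmxA).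

End MatrixExpansion.

(* After expansion the identity is linear in the products, whose entries are
   then atoms for ring. *)
Ltac mxring :=
  rewrite ?mxexpand; apply/matrixP => ? ?;
  rewrite ?(addmxE, oppmxE, scalemxE); ring.

(** * Newton's method for the equation of the inverse *)

Section RiccatiNewton.
Variable R : realType.
Variables (n : nat) (A W S : 'M[R]_n).
Hypotheses (Wpd : spd W) (Ss : S^T = S) (Sp : psd S).

Definition dual_riccati (X : 'M[R]_n) := X *m W *m X + A^T *m X + X *m A - S.

(* The second condition says that A + W X is antistable. *)
Definition newton_domain (X : 'M[R]_n) := 
  [/\ spd X, exists2 Y, spd Y & spd ((A + W *m X)^T *m Y + Y *m (A + W *m X)) &
      psd (dual_riccati X)].

Lemma newton_start : exists X, newton_domain X.
Proof.
pose M := A + A^T - S.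
have Ms : M^T = M by rewrite /M linearB linearD /= trmxK Ss [A^T + A]addrC.
have [e e0 We] := spd_lower Wpd.
have [f f0 Mf] := bf_upper Ms.
have [Ws _] := Wpd.
(* As W >= e and M >= - f, this c gives c W + M >= c e - f = e > 0. It is also at least 1, so that
   (c - 1) S >= 0 in the residual at c. *)
pose c := f / e + 1.
have c1 : 1 <= c by rewrite lerDr divr_ge0 // ltW.
have c0 : 0 < c by apply: lt_le_trans c1.
have cWM : spd (c *: W + M).
  split; first by rewrite linearD linearZ /= Ws Ms.
  move=> x x0; rewrite -/(bf _ _ _) bfD bfZ.
  have := We x; have := Mf x; have := bf1_gt0 x0.
  rewrite ler_norml => X0 /andP[h1 _] h2.
  have : c * (e * bf 1%:M x x) <= c * bf W x x by rewrite ler_pM2l.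
  have -> : c * (e * bf 1%:M x x) = (f + e) * bf 1%:M x x.
    by rewrite /c; field; rewrite gt_eqF.
  by nra.
exists c%:M; split.
- by rewrite -scalemx1; apply: spdZ => //; exact: spd1.
- exists 1%:M; first exact: spd1.
  rewrite linearD /= trmx_mul Ws tr_scalar_mx !mulmx1 !mul1mx mul_scalar_mx mul_mx_scalar.
  have -> : A^T + c *: W + (A + c *: W) = (c *: W + M) + (S + c *: W).
    by rewrite /M; mxring.
  apply: spd_psdD => //; first by rewrite linearD linearZ /= Ws Ss.
  by apply: psdD => //; apply: psdZ; [exact: ltW | exact: spd_psd].
- have -> : dual_riccati c%:M = c *: (c *: W + M) + (c - 1) *: S.
    rewrite /dual_riccati !mul_mx_scalar !mul_scalar_mx /M.
    by mxring.
  apply: psdD; first by apply: psdZ; [exact: ltW | exact: spd_psd].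
  by apply: psdZ => //; rewrite subr_ge0.
Qed.

(** The new iterate solves the equation linearised at X, that is (A + W X)^T X' + X' (A + W X) = S +
    X W X. The map being quadratic, the residual at X' is exactly the second-order term, which is
    nonnegative. The difference X - X' solves a Lyapunov equation whose right-hand side is the
    residual at X, so the iterates decrease. *)
Lemma newton_step X : newton_domain X -> exists X', [/\ newton_domain X',
  psd (X - X') & dual_riccati X' = (X - X') *m W *m (X - X')].
Proof.
move=> [Xpd [Y Ypd Bpd] Fp]; have [Xs _] := Xpd; have [Ws _] := Wpd.
pose V := S + X *m W *m X.
have XWX (Z : 'M[R]_n) : Z^T = Z -> (Z *m W *m Z)^T = Z *m W *m Z.
  by move=> Zs; rewrite !trmx_mul Zs Ws mulmxA.
have XWXp (Z : 'M[R]_n) : Z^T = Z -> psd (Z *m W *m Z).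
  by move=> Zs; rewrite -[X in X *m W]Zs; apply: psd_congr; exact: spd_psd.
have XWXpd (Z : 'M[R]_n) : spd Z -> spd (Z *m W *m Z).
  move=> Zpd; rewrite -[X in X *m W](proj1 Zpd); apply: spd_congr => //.
  by move=> x; apply: unitmx_inj0; exact: spd_unit.
have Vpd : spd V by rewrite /V addrC; apply: spd_psdD => //; exact: XWXpd.
have [X' X's X'E] := lyap_solve Ypd Bpd (proj1 Vpd).
have X'pd : spd X' by apply: (lyap_spd Ypd Bpd) => //; rewrite X'E.
have AX' : A^T *m X' + X' *m A = V - X *m W *m X' - X' *m W *m X.
  rewrite -X'E linearD /= trmx_mul Xs Ws.
  by mxring.
have FE : dual_riccati X' = (X - X') *m W *m (X - X').
  rewrite /dual_riccati -[_ + _ *m A]addrA AX' /V.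
  by mxring.
have X'p : psd (dual_riccati X').
  by rewrite FE; apply: XWXp; rewrite linearB /= Xs X's.
exists X'; split => //.
(* X' certifies its own antistability: the Lyapunov expression is X' W X' + S plus the residual. *)
- split => //; exists X' => //.
  have -> : (A + W *m X')^T *m X' + X' *m (A + W *m X') =
      X' *m W *m X' + (S + dual_riccati X').
    rewrite /dual_riccati linearD /= trmx_mul X's Ws.
    by mxring.
  apply: spd_psdD; first exact: XWXpd.
    by rewrite FE linearD /= Ss XWX // linearB /= Xs X's.
  exact: psdD.
- apply: (lyap_psd Ypd Bpd); first by rewrite linearB /= Xs X's.
  have -> : (A + W *m X)^T *m (X - X') + (X - X') *m (A + W *m X)
      = dual_riccati X.
    have := X'E; rewrite /V /dual_riccati linearD /= trmx_mul Xs Ws => h.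
    transitivity ((A^T + X *m W) *m X + X *m (A + W *m X) - (S + X *m W *m X)).
      by rewrite -h; mxring.
    by mxring.
  exact: Fp.
Qed.

(** The Newton iterates decrease and stay above 0, so they converge. Strict positivity is lost in
    the limit, which is why only a semidefinite solution is obtained here. *)
Lemma dual_riccati_solution : exists X, [/\ X^T = X, psd X & dual_riccati X = 0].
Proof.
have [X0 X0d] := newton_start.
have /choice[f fP] : forall X, exists X', newton_domain X ->
    [/\ newton_domain X', psd (X - X') &
      dual_riccati X' = (X - X') *m W *m (X - X')].
  move=> X; have [/newton_step[X' X'P]|nX] := pselect (newton_domain X).
    by exists X'.
  by exists X.
pose s k := iter k f X0.
have sd k : newton_domain (s k) by elim: k => // k /fP[].
have sS k : [/\ newton_domain (s k.+1), psd (s k - s k.+1) &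
    dual_riccati (s k.+1) = (s k - s k.+1) *m W *m (s k - s k.+1)].
  by apply: fP; exact: sd.
have ss k : (s k)^T = s k by have [[]] := sd k.
have sp k : psd (s k) by have [/spd_psd] := sd k.
have bfcvg x : cvgn (fun k => bf (s k) x x).
  apply: nonincreasing_is_cvgn.
    apply/nonincreasing_seqP => k; have [_ h _] := sS k.
    by have := h x; rewrite bfB subr_ge0.
  by exists 0 => _ [k _ <-]; exact: sp.
pose L := \matrix_(i, j) limn (fun k => s k i j).
have sL : mcvg \oo s L.
  move=> i j; rewrite mxE; apply: (_ : cvgn (fun k => s k i j)).
  (* Polarisation: monotone convergence is available for the quadratic forms only, and every entry
     is a combination of three of them. *)
  have -> : (fun k => s k i j) = (fun k => 2^-1 *
      (bf (s k) (delta_mx i 0 + delta_mx j 0) (delta_mx i 0 + delta_mx j 0)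
       - bf (s k) (delta_mx i 0) (delta_mx i 0)
       - bf (s k) (delta_mx j 0) (delta_mx j 0))).
    apply/funext => k; have h : s k j i = s k i j by rewrite -[in LHS]ss mxE.
    by rewrite !(bfDl, bfDr) !bf_delta h; field.
  apply: is_cvgMr; apply: is_cvgB; last exact: bfcvg.
  by apply: is_cvgB; exact: bfcvg.
have sL' : mcvg \oo (fun k => s k.+1) L.
  by move=> i j; have := sL i j; rewrite -cvg_shiftS.
exists L; split.
- have sLT : mcvg \oo s L^T by apply: mcvg_eq (mcvg_tr sL) => k; rewrite ss.
  exact: (mcvg_unique sLT sL).
- move=> x; apply: (cvgr_to_ge (cvg_bf (x := x) (y := x) sL)).
  by apply: nearW => k; exact: sp.
(* The residual is quadratic in the last step, and the steps of a convergent sequence tend to 0. *)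
have h0 : mcvg \oo (fun k => dual_riccati (s k.+1)) 0.
  have -> : 0 = (L - L) *m W *m (L - L) by rewrite subrr mulmx0.
  apply: mcvg_eq (_ : mcvg \oo (fun k => (s k - s k.+1) *m W *m (s k - s k.+1)) _).
    by move=> k; have [] := sS k.
  have h1 : mcvg \oo (fun k => s k - s k.+1) (L - L) by exact: mcvgB.
  by apply: mcvgM => //; apply: mcvgM => //; exact: mcvg_cst.
have h2 : mcvg \oo (fun k => dual_riccati (s k.+1)) (dual_riccati L).
  apply: mcvgB; last exact: mcvg_cst.
  apply: mcvgD; last by apply: mcvgM => //; exact: mcvg_cst.
  apply: mcvgD; last by apply: mcvgM => //; exact: mcvg_cst.
  by apply: mcvgM => //; apply: mcvgM => //; exact: mcvg_cst.
exact: (mcvg_unique h2 h0).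
Qed.
End RiccatiNewton.

(** * Positive definiteness from observability *)

Section Observability.
Variable R : realType.

Lemma observable_ker n p (A : 'M[R]_n) (C : 'M[R]_(p, n)) (v : 'cV[R]_n) :
  observable A C -> (forall k, C *m A ^+ k *m v = 0) -> v = 0.
Proof.
move=> obs Cv; have full : row_full (\mxcol_(i < n) (C *m A ^+ i)).
  by rewrite /row_full -[X in _ == X]obs.
apply: (row_full_inj full); rewrite mulmx0 mxcol_mul.
by apply/eqP; rewrite -mxcol0; apply/eqP/eq_mxcol => i; exact: Cv.
Qed.

(** If X y = 0, the equation applied to y reads X A y = C^T Z C y. Pairing with y gives C y = 0, as
    Z is positive definite, and then X A y = 0. So the kernel of X is stable under A and contained
    in that of C. *)
Lemma dual_riccati_spd n p (A W X : 'M[R]_n) (C : 'M[R]_(p, n)) (Z : 'M[R]_p) :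
  spd Z -> observable A C -> X^T = X -> psd X ->
  dual_riccati A W (C^T *m Z *m C) X = 0 -> spd X.
Proof.
move=> Zpd obs Xs Xp X0; split => // x x0.
rewrite -/(bf _ _ _) lt_neqAle Xp andbT eq_sym; apply: contra_neq x0.
move=> /(psd_ker Xs Xp) Xx; apply: (observable_ker obs).
have step (y : 'cV[R]_n) : X *m y = 0 -> C *m y = 0 /\ X *m (A *m y) = 0.
  move=> Xy; have Fy : dual_riccati A W (C^T *m Z *m C) X *m y = 0.
    by rewrite X0 mul0mx.
  have E : X *m A *m y = C^T *m Z *m C *m y.
    apply/eqP; rewrite -subr_eq0; apply/eqP; rewrite -[RHS]Fy /dual_riccati.
    by rewrite !(mulmxDl, mulmxBl, mulNmx) -!(mulmxA _ X y) Xy !mulmx0 !add0r.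
  have Cy : C *m y = 0.
    apply/eqP; apply: contraT => Cy.
    have := proj2 Zpd _ Cy; rewrite -/(bf _ _ _) -bf_congr /bf -mulmxA -E.
    by rewrite !mulmxA -{1}Xs -trmx_mul Xy trmx0 !mul0mx mxE ltxx.
  by split => //; rewrite mulmxA E -mulmxA Cy mulmx0.
have XA k : X *m (A ^+ k *m x) = 0.
  elim: k => [|k IH]; first by rewrite expr0 mul1mx.
  by rewrite exprS -mulmxE -mulmxA; have [] := step _ IH.
by move=> k; rewrite -mulmxA; have [] := step _ (XA k).
Qed.
End Observability.

(** * The equation for P and uniqueness of its zero *)

Section PrimalRiccati.
Variables (R : realType) (n : nat) (A W S : 'M[R]_n).
Hypotheses (Wpd : spd W) (Ss : S^T = S) (Sp : psd S).

Definition ric (P : 'M[R]_n) := A *m P + P *m A^T + W - P *m S *m P.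

Lemma ric_invmx X : X \in unitmx -> dual_riccati A W S X = 0 ->
  ric (invmx X) = 0.
Proof.
move=> Xu X0; transitivity (invmx X *m dual_riccati A W S X *m invmx X).
  rewrite /ric /dual_riccati !mxexpand !(mulmxK Xu) mulVmx // !mul1mx.
  by mxring.
by rewrite X0 mulmx0 mul0mx.
Qed.

(** The terms in A are linear in P v and cancel, the one in W leaves 1 - d, and the quadratic one
    leaves d - d^2 = d (1 - d). Both the uniqueness of Q and the contraction rest on this common
    factor 1 - d. *)
Lemma ric_pencil P1 P2 v d : P1^T = P1 -> P2^T = P2 ->
    P1 *m v = d *: (P2 *m v) ->
  bf (ric P1 - d *: ric P2) v v =
  (1 - d) * (bf W v v + d * bf S (P2 *m v) (P2 *m v)).
Proof.
move=> P1s P2s Pv.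
have e1 : bf (A *m P1) v v = d * bf (A *m P2) v v.
  by rewrite !bf_mulmx Pv bfZr.
have e2 : bf (P1 *m A^T) v v = d * bf (P2 *m A^T) v v.
  by rewrite ![bf (_ *m A^T) _ _]bf_tr !trmx_mul trmxK P1s P2s.
have e3 : bf (P1 *m S *m P1) v v = d ^+ 2 * bf S (P2 *m v) (P2 *m v).
  by rewrite -{1}P1s bf_congr Pv bfZl bfZr; ring.
have e4 : bf (P2 *m S *m P2) v v = bf S (P2 *m v) (P2 *m v).
  by rewrite -{1}P2s bf_congr.
by rewrite /ric !(bfB, bfD, bfZ) e1 e2 e3 e4; ring.
Qed.

(** At two zeros the left-hand side of [ric_pencil] vanishes while its second factor is positive, so
    every generalised eigenvalue is 1. *)
Lemma ric_unique P1 P2 : spd P1 -> spd P2 -> ric P1 = 0 -> ric P2 = 0 -> P1 = P2.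
Proof.
move=> P1pd P2pd r1 r2; have [P1s _] := P1pd; have [P2s _] := P2pd.
have [U [d [Uu P2E P1E]]] := simdiag P1s P2pd.
have d0 i : 0 < d 0 i by apply: (pencil_spd Uu); rewrite -P1E.
have d1 i : d 0 i = 1.
  have [vE _ v0] := pencil_vector d i Uu.
  move: vE; rewrite -P1E -P2E => vE.
  have := ric_pencil P1s P2s vE; rewrite r1 r2 scaler0 subr0.
  rewrite {1}/bf mulmx0 mul0mx mxE => /esym/eqP; rewrite mulf_eq0.
  rewrite [X in _ || X]gt_eqF ?orbF; first by rewrite subr_eq0 eq_sym => /eqP.
  by rewrite ltr_pwDl ?(proj2 Wpd) // mulr_ge0 // ltW.
rewrite P1E P2E; have -> : diag_mx d = 1%:M.
  by apply/matrixP => i j; rewrite !mxE d1.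
by rewrite mulmx1.
Qed.
End PrimalRiccati.

(** * The affine-invariant distance *)

Section Spectrum.
Variable R : realType.

(** Unique factorisation: whichever list [xget] picks in [spectrum], sums over it do not depend on
    the choice. *)
Lemma prod_XsubC_perm (s t : seq R) :
  \prod_(a <- s) ('X - a%:P) = \prod_(a <- t) ('X - a%:P) -> perm_eq s t.
Proof.
elim: s t => [|a s IH] t.
  move/(congr1 (fun p : {poly R} => size p)); rewrite big_nil size_prod_XsubC.
  by rewrite size_poly1; case: t.
move=> st; have at_ : a \in t.
  by rewrite -root_prod_XsubC -st root_prod_XsubC mem_head.
rewrite perm_sym (perm_trans (perm_to_rem at_)) // perm_cons perm_sym.
apply: IH; move: st; rewrite (perm_big _ (perm_to_rem at_)) !big_cons /=.
by apply: mulfI; rewrite polyXsubC_eq0.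
Qed.

Lemma char_poly_conj n (K M : 'M[R]_n) : K \in unitmx ->
  char_poly (K *m M *m invmx K) = char_poly M.
Proof.
move=> Ku; rewrite /char_poly.
have Kc : map_mx polyC K *m map_mx polyC (invmx K) = 1%:M.
  by rewrite -map_mxM mulmxV // map_mx1.
have -> : char_poly_mx (K *m M *m invmx K) =
    map_mx polyC K *m char_poly_mx M *m map_mx polyC (invmx K).
  rewrite /char_poly_mx mulmxBr mulmxBl scalar_mxC -[X in _ = X - _]mulmxA Kc mulmx1.
  by rewrite !map_mxM.
by rewrite !det_mulmx mulrAC -det_mulmx Kc det1 mul1r.
Qed.

(** Diagonalisability over R exhibits a factorisation into linear factors, so [spectrum] does not
    fall back on its default value. *)
Lemma spectrum_conj n (K M : 'M[R]_n) (d : 'rV[R]_n) (f : R -> R) :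
    K \in unitmx -> M = K *m diag_mx d *m invmx K ->
  \sum_(a <- spectrum M) f a = \sum_i f (d 0 i).
Proof.
move=> Ku ME.
have cM : char_poly M = \prod_(a <- [seq d 0 i | i <- enum 'I_n]) ('X - a%:P).
  rewrite ME char_poly_conj // char_poly_trig ?diag_mx_is_trig // big_map.
  by rewrite big_enum; apply: eq_bigr => i _; rewrite mxE eqxx mulr1n.
have : char_poly M = \prod_(a <- spectrum M) ('X - a%:P).
  rewrite /spectrum; apply: (@xgetPex _ [::]
    [set s | char_poly M = \prod_(a <- s) ('X - a%:P)]).
  by eexists; exact: cM.
rewrite cM => /prod_XsubC_perm sp; rewrite -(perm_big _ sp) big_map big_enum.
by [].
Qed.

(** The squared distance, because the square root is not differentiable where two solutions meet. *)
Definition sqdist n (P Q : 'M[R]_n) : R :=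
  \sum_(a <- spectrum (P *m invmx Q)) ln a ^+ 2.

Lemma sqdist_pencil n (U : 'M[R]_n) (d : 'rV[R]_n) : U \in unitmx ->
  sqdist (U *m diag_mx d *m U^T) (U *m U^T) = \sum_i ln (d 0 i) ^+ 2.
Proof.
move=> Uu; have UTu : U^T \in unitmx by rewrite unitmx_tr.
apply: (spectrum_conj (fun a => ln a ^+ 2) Uu).
have -> : invmx (U *m U^T) = invmx U^T *m invmx U.
  have UU : U *m U^T \in unitmx by rewrite unitmx_mul Uu.
  apply: (can_inj (mulKmx UU)); rewrite mulmxV //.
  by rewrite mulmxA mulmxK // mulmxV.
by rewrite !mulmxA mulmxK.
Qed.

Lemma spd_distE n (P Q : 'M[R]_n) : spd_dist P Q = Num.sqrt (sqdist P Q).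
Proof. by []. Qed.

(** With T = U D^(1/2), P = T T^T and Q = T D^-1 T^T: exchanging the matrices inverts the
    eigenvalues, which only changes the signs of the logarithms. *)
Lemma sqdist_sym n (P Q : 'M[R]_n) : spd P -> spd Q -> sqdist P Q = sqdist Q P.
Proof.
move=> Ppd Qpd; have [U [d [Uu QE PE]]] := simdiag (proj1 Ppd) Qpd.
have d0 i : 0 < d 0 i by apply: (pencil_spd Uu); rewrite -PE.
pose s : 'rV[R]_n := \row_i Num.sqrt (d 0 i).
pose e : 'rV[R]_n := \row_i (d 0 i)^-1.
have s0 i : s 0 i != 0 by rewrite mxE gt_eqF // sqrtr_gt0.
pose T := U *m diag_mx s.
have Tu : T \in unitmx.
  rewrite unitmx_mul Uu unitmxE det_diag unitfE.
  by apply/prodf_neq0 => i _.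
have TT : T *m T^T = P.
  rewrite /T trmx_mul tr_diag_mx mulmxA -(mulmxA U) mulmx_diag PE.
  congr (_ *m diag_mx _ *m _); apply/rowP => i; rewrite !mxE.
  by rewrite -expr2 sqr_sqrtr // ltW.
have TeT : T *m diag_mx e *m T^T = Q.
  have ses : diag_mx s *m diag_mx e *m diag_mx s = 1%:M.
    rewrite !mulmx_diag; apply/matrixP => i j; rewrite !mxE; congr (_ *+ _).
    by rewrite mulrAC -expr2 sqr_sqrtr ?ltW // mulfV // gt_eqF.
  transitivity (U *m (diag_mx s *m diag_mx e *m diag_mx s) *m U^T).
    by rewrite /T trmx_mul tr_diag_mx !mulmxA.
  by rewrite ses mulmx1 QE.
have -> : sqdist Q P = \sum_i ln (e 0 i) ^+ 2.
  by rewrite -TT -TeT sqdist_pencil.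
rewrite QE PE sqdist_pencil //.
by apply: eq_bigr => i _; rewrite mxE lnV ?posrE // sqrrN.
Qed.

Lemma spd_dist_sym n (P Q : 'M[R]_n) : spd P -> spd Q ->
  spd_dist P Q = spd_dist Q P.
Proof. by move=> Ppd Qpd; rewrite !spd_distE (sqdist_sym Ppd Qpd). Qed.

Lemma spd_dist_refl n (Q : 'M[R]_n) : spd Q -> spd_dist Q Q = 0.
Proof.
move=> Qpd; have [U [_ [Uu QE _]]] := simdiag (proj1 Qpd) Qpd.
have QQ : U *m diag_mx (const_mx 1) *m U^T = Q by rewrite diag_const_mx mulmx1.
rewrite spd_distE -{1}QQ QE sqdist_pencil // big1 ?sqrtr0 // => i _.
by rewrite mxE ln1 expr0n.
Qed.

(** Each |ln d_i| is at most the distance, so d_i >= exp (- distance). This order bound is what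
    makes the balls bounded. *)
Lemma sqdist_bound n (P Q : 'M[R]_n) : spd P -> spd Q ->
  forall x, bf P x x <= expR (Num.sqrt (sqdist Q P)) * bf Q x x.
Proof.
move=> Ppd Qpd x; have [U [d [Uu PE QE]]] := simdiag (proj1 Qpd) Ppd.
have d0 i : 0 < d 0 i by apply: (pencil_spd Uu); rewrite -QE.
rewrite QE {2}PE sqdist_pencil // pencil_psd PE pencil_base mulr_sumr.
apply: ler_sum => i _; rewrite mulrA -[leLHS]mul1r ler_wpM2r ?sqr_ge0 //.
rewrite -[d 0 i in leRHS]lnK ?posrE // -expRD -expR0 ler_expR.
suff : `|ln (d 0 i)| <= Num.sqrt (\sum_j ln (d 0 j) ^+ 2).
  by rewrite ler_norml => /andP[]; lra.
rewrite -sqrtr_sqr ler_wsqrtr // (bigD1 i) //= lerDl sumr_ge0 // => j _.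
exact: sqr_ge0.
Qed.
End Spectrum.

(** * Second-order expansion of the sum of squared logarithms *)

Section SpectralTaylor.
Variable R : realType.

(** The estimate must hold for all y >= a and not only near x, because each eigenvalue of the
    perturbed matrix is later compared with every d_i, including distant ones. It comes from ln z <=
    z - 1 applied to z = y / x and to its inverse. *)
Lemma sqr_ln_taylor (x a : R) : 0 < x -> 0 < a ->
  exists2 C, 0 <= C & forall y, a <= y ->
    `|ln y ^+ 2 - ln x ^+ 2 - 2 * ln x / x * (y - x)| <= C * (y - x) ^+ 2.
Proof.
move=> x0 a0.
(* With z = y / x, the error is 2 ln x (ln z - (z - 1)) + (ln z)^2; the first summand bounds the
   first term, the other two bound the square. *)
exists (2 * `|ln x| / (x * a) + (x ^- 2 + a ^- 2)).
  by rewrite !addr_ge0 // ?divr_ge0 ?mulr_ge0 ?invr_ge0 ?sqr_ge0 // ltW.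
move=> y ay; have y0 : 0 < y by apply: lt_le_trans ay.
pose z := y / x; have z0 : 0 < z by rewrite divr_gt0.
have yE : y = x * z by rewrite /z mulrC divfK // gt_eqF.
have zVle : z^-1 <= x / a.
  by rewrite /z invf_div ler_pM2l // lef_pV2.
clearbody z.
have lnz1 : ln z <= z - 1.
  by have := @le_ln1Dx R (z - 1); rewrite subrKC; apply; lra.
have lnz2 : (z - 1) / z <= ln z.
  have := @le_ln1Dx R (z^-1 - 1); rewrite subrKC lnV ?posrE // => h.
  have zV : 0 < z^-1 by rewrite invr_gt0.
  have : - ln z <= z^-1 - 1 by apply: h; lra.
  have -> : (z - 1) / z = 1 - z^-1 by field; rewrite gt_eqF.
  by lra.
pose u := (z - 1) ^+ 2.
have u0 : 0 <= u by exact: sqr_ge0.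
have e1 : - (u / z) <= ln z - (z - 1) <= 0.
  rewrite subr_le0 lnz1 andbT.
  have -> : - (u / z) = (z - 1) / z - (z - 1) by rewrite /u; field; rewrite gt_eqF.
  by rewrite lerD2r.
have e2 : ln z ^+ 2 <= u + u / z ^+ 2.
  have uz : u / z ^+ 2 = ((z - 1) / z) ^+ 2 by rewrite /u exprMn exprVn.
  have uz0 : 0 <= u / z ^+ 2 by rewrite uz sqr_ge0.
  have [l0|l0] := lerP 0 (ln z).
    apply: le_trans (_ : u <= _); last by rewrite lerDl.
    by rewrite /u ler_sqr ?nnegrE //; lra.
  apply: le_trans (_ : u / z ^+ 2 <= _); last by rewrite lerDr.
  by rewrite uz -(sqrrN (ln z)) -(sqrrN (_ / z)) ler_sqr ?nnegrE; [lra|lra|lra].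
have -> : ln y ^+ 2 - ln x ^+ 2 - 2 * ln x / x * (y - x) =
    2 * ln x * (ln z - (z - 1)) + ln z ^+ 2.
  rewrite yE lnM ?posrE //; field; exact: lt0r_neq0.
apply: le_trans (ler_normD _ _) _; rewrite [leRHS]mulrDl lerD //.
  rewrite normrM (_ : _ * (y - x) ^+ 2 = `|2 * ln x| * (u * x / a)); last first.
    by rewrite normrM ger0_norm // yE /u; field; rewrite !gt_eqF.
  rewrite ler_wpM2l // ler0_norm; last by case/andP: e1.
  case/andP: e1 => h _; rewrite lerNl (le_trans _ h) // lerN2.
  by rewrite -mulrA ler_wpM2l.
rewrite ger0_norm ?sqr_ge0 // (le_trans e2) //.
have -> : (x ^- 2 + a ^- 2) * (y - x) ^+ 2 = u + u * (x / a) ^+ 2.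
  by rewrite yE /u; field; rewrite !gt_eqF.
by rewrite lerD2l ler_wpM2l // -exprVn ler_sqr ?nnegrE ?invr_ge0 ?divr_ge0 // ltW.
Qed.

Definition abs_sum m n (E : 'M[R]_(m, n)) := \sum_i \sum_j `|E i j|.

Lemma abs_sum_ge0 m n (E : 'M[R]_(m, n)) : 0 <= abs_sum E.
Proof. by apply: sumr_ge0 => i _; exact: sumr_ge0. Qed.

Lemma row_abs_sum m n (E : 'M[R]_(m, n)) i : \sum_j `|E i j| <= abs_sum E.
Proof.
by rewrite /abs_sum (bigD1 i) //= lerDl; apply: sumr_ge0 => k _; exact: sumr_ge0.
Qed.

Lemma col_abs_sum m n (E : 'M[R]_(m, n)) j : \sum_i `|E i j| <= abs_sum E.
Proof.
rewrite /abs_sum; apply: ler_sum => i _.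
by rewrite (bigD1 j) //= lerDl; exact: sumr_ge0.
Qed.

Lemma mulmx_entry_le m n p (X : 'M[R]_(m, n)) (Y : 'M[R]_(n, p)) a i j :
  (forall k, `|Y k j| <= a) -> `|(X *m Y) i j| <= (\sum_k `|X i k|) * a.
Proof.
move=> Ya; rewrite mxE mulr_suml; apply: le_trans (ler_norm_sum _ _ _) _.
by apply: ler_sum => k _; rewrite normrM ler_wpM2l.
Qed.

Lemma mulmx_entry_ler m n p (X : 'M[R]_(m, n)) (Y : 'M[R]_(n, p)) a i j :
  (forall k, `|X i k| <= a) -> `|(X *m Y) i j| <= a * (\sum_k `|Y k j|).
Proof.
move=> Ya; rewrite mxE mulr_sumr; apply: le_trans (ler_norm_sum _ _ _) _.
by apply: ler_sum => k _; rewrite normrM ler_wpM2r.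
Qed.

Lemma sum_bound n (f : 'I_n -> R) b : (forall i, f i <= b) -> \sum_i f i <= n%:R * b.
Proof.
move=> fb; rewrite mulr_natl -[n in _ *+ n]card_ord -sumr_const.
by apply: ler_sum => i _.
Qed.

(* With M = K diag(l) K^-1, the weights K_ij (K^-1)_ji have unit row and column
   sums, and the factors of K_ij (K^-1)_ji (l_j - d_i)^2 are entries of
   (M - diag d) K and K^-1 (M - diag d). *)
Lemma sqr_ln_spectrum_taylor n (d : 'rV[R]_n) (b : R) :
    (forall i, 0 < d 0 i) -> 0 < b ->
  exists2 C, 0 <= C & forall (K : 'M[R]_n) (l : 'rV[R]_n), K \in unitmx ->
    (forall j, 0 < l 0 j) ->
    let M := K *m diag_mx l *m invmx K in
    (forall i j, `|K i j| <= b) -> (forall i j, `|invmx K i j| <= b) ->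
    (forall i j, `|invmx M i j| <= b) ->
    `|\sum_j ln (l 0 j) ^+ 2 - \sum_i ln (d 0 i) ^+ 2
      - \sum_i 2 * ln (d 0 i) / d 0 i * (M i i - d 0 i)|
    <= C * abs_sum (M - diag_mx d) ^+ 2.
Proof.
move=> d0 b0.
(* A lower bound for every l_j: the inverse of l_j is a diagonal entry of K^-1 M^-1 K, a product of
   three matrices with entries at most b. The added 1 keeps a positive when n = 0. *)
pose a := (n%:R * (n%:R * b * b) * b + 1)^-1.
have a0 : 0 < a by rewrite invr_gt0 ltr_wpDl // !mulr_ge0 // ltW.
have /choice[c cP] : forall i, exists c, 0 <= c /\ forall y, a <= y ->
    `|ln y ^+ 2 - ln (d 0 i) ^+ 2 - 2 * ln (d 0 i) / d 0 i * (y - d 0 i)|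
      <= c * (y - d 0 i) ^+ 2.
  by move=> i; have [c c0 cP] := sqr_ln_taylor (d0 i) a0; exists c.
exists (\sum_i \sum_(j < n) c i * b ^+ 2).
  apply: sumr_ge0 => i _; apply: sumr_ge0 => j _.
  by rewrite mulr_ge0 ?sqr_ge0 //; have [] := cP i.
move=> K l Ku l0 M Kb K'b M'b.
pose E := M - diag_mx d; pose q := abs_sum E.
have lVu : diag_mx l \in unitmx.
  rewrite unitmxE det_diag unitfE; apply/prodf_neq0 => i _.
  by rewrite gt_eqF.
have Mu : M \in unitmx by rewrite !unitmx_mul Ku lVu unitmx_inv Ku.
have la j : a <= l 0 j.
  have lV : (invmx K *m invmx M *m K) j j = (l 0 j)^-1.
    have -> : invmx K *m invmx M *m K = diag_mx (\row_i (l 0 i)^-1).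
      have e1 : invmx K *m M *m K = diag_mx l.
        by rewrite /M !mulmxA mulVmx // mul1mx mulmxKV.
      have e2 : (invmx K *m invmx M *m K) *m diag_mx l = 1%:M.
        rewrite -e1; move: (M) Mu => N Nu.
        by rewrite !mulmxA mulmxK // mulmxKV // mulVmx.
      apply: (can_inj (mulmxK lVu)); rewrite e2 mulmx_diag.
      apply/matrixP => i k; rewrite !mxE mulVf //; exact: lt0r_neq0.
    by rewrite !mxE eqxx mulr1n.
  rewrite -[l 0 j]invrK /a lef_pV2 ?posrE ?invr_gt0 //; last first.
    by rewrite ltr_wpDl // !mulr_ge0 // ltW.
  apply: le_trans (ler_norm _) _; rewrite -lV.
  apply: le_trans (_ : _ <= n%:R * (n%:R * b * b) * b) _; last by rewrite lerDl.
  apply: le_trans (mulmx_entry_le _ _ (a := b) _) _ => //.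
  rewrite (ler_wpM2r (ltW b0)) //; apply: sum_bound => k.
  apply: le_trans (mulmx_entry_le _ _ (a := b) _) _ => //.
  by rewrite (ler_wpM2r (ltW b0)) //; apply: sum_bound => k'.
pose w i j := K i j * invmx K j i.
have wr i : \sum_j w i j = 1.
  by have /matrixP/(_ i i) := mulmxV Ku; rewrite !mxE eqxx.
have wc j : \sum_i w i j = 1.
  transitivity ((invmx K *m K) j j); last by rewrite mulVmx // mxE eqxx.
  by rewrite mxE; apply: eq_bigr => i _; rewrite /w mulrC.
have wM i : \sum_j w i j * (l 0 j - d 0 i) = M i i - d 0 i.
  under eq_bigr do rewrite mulrBr.
  rewrite sumrB -mulr_suml wr mul1r; congr (_ - _).
  by rewrite /M mxE; apply: eq_bigr => j _; rewrite mul_mx_diag mxE /w; ring.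
have EK i j : (E *m K) i j = K i j * (l 0 j - d 0 i).
  rewrite mulmxBl mxE [X in _ + X]mxE mul_diag_mx /M mulmxKV // mul_mx_diag !mxE.
  by ring.
have KE i j : (invmx K *m E) j i = invmx K j i * (l 0 j - d 0 i).
  rewrite mulmxBr mxE [X in _ + X]mxE mul_mx_diag /M !mulmxA mulVmx // mul1mx.
  by rewrite mul_diag_mx !mxE; ring.
(* The unit row and column sums, together with [wM], spread the whole error over the pairs (i, j),
   where it is a weighted mean of scalar Taylor errors. *)
have -> : \sum_j ln (l 0 j) ^+ 2 - \sum_i ln (d 0 i) ^+ 2
    - \sum_i 2 * ln (d 0 i) / d 0 i * (M i i - d 0 i) =
  \sum_i \sum_j w i j * (ln (l 0 j) ^+ 2 - ln (d 0 i) ^+ 2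
    - 2 * ln (d 0 i) / d 0 i * (l 0 j - d 0 i)).
  have -> : \sum_j ln (l 0 j) ^+ 2 = \sum_i \sum_j w i j * ln (l 0 j) ^+ 2.
    by rewrite exchange_big; apply: eq_bigr => j _; rewrite -mulr_suml wc mul1r.
  rewrite -!sumrB; apply: eq_bigr => i _.
  have di : ln (d 0 i) ^+ 2 = \sum_j w i j * ln (d 0 i) ^+ 2.
    by rewrite -mulr_suml wr mul1r.
  rewrite -wM mulr_sumr {1}di -!sumrB.
  by apply: eq_bigr => j _; ring.
apply: le_trans (ler_norm_sum _ _ _) _; rewrite mulr_suml; apply: ler_sum => i _.
apply: le_trans (ler_norm_sum _ _ _) _; rewrite mulr_suml; apply: ler_sum => j _.
have [ci0 cPi] := cP i; rewrite normrM.
apply: le_trans (ler_wpM2l (normr_ge0 _) (cPi _ (la j))) _.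
have -> : `|w i j| * (c i * (l 0 j - d 0 i) ^+ 2) =
    c i * (`|(E *m K) i j| * `|(invmx K *m E) j i|).
  rewrite EK KE /w !normrM -[(l 0 j - d 0 i) ^+ 2]ger0_norm ?sqr_ge0 // normrX.
  by ring.
rewrite -mulrA ler_wpM2l //.
have -> : b ^+ 2 * abs_sum (M - diag_mx d) ^+ 2 = (q * b) * (b * q).
  by rewrite -/E -/q; ring.
apply: ler_pM => //.
  apply: le_trans (mulmx_entry_le _ _ (a := b) _) _ => //.
  by rewrite ler_wpM2r ?row_abs_sum // ltW.
apply: le_trans (mulmx_entry_ler _ _ (a := b) _) _ => //.
by rewrite ler_wpM2l ?col_abs_sum // ltW.
Qed.
End SpectralTaylor.

(** * Derivatives of matrix-valued functions *)

Section MatrixDerivative.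
Variable R : realType.

Lemma is_derive_quotient (f : R -> R) (x D : R) :
  is_derive x 1 f D <-> h^-1 * (f (h + x) - f x) @[h --> 0^'] --> D.
Proof.
have qE : (fun h : R => h^-1 *: ((f \o shift x) (h *: (1 : R)) - f x)) =
    (fun h => h^-1 * (f (h + x) - f x)).
  by apply/funext => h /=; rewrite [h *: 1]mulr1.
split.
  by move=> [df <-]; rewrite -qE; exact: df.
move=> fD; have cf : derivable f x 1.
  by rewrite /derivable qE; apply/cvg_ex; exists D.
by apply: DeriveDef => //; rewrite /derive qE; exact: cvg_lim.
Qed.

Definition mder m n (X : R -> 'M[R]_(m, n)) (t : R) (D : 'M[R]_(m, n)) : Prop :=
  forall i j, is_derive t 1 (fun s => X s i j) (D i j).

Lemma mderP m n (X : R -> 'M[R]_(m, n)) (t : R) (D : 'M[R]_(m, n)) : is_derive t 1 X D <-> mder X t D.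
Proof.
split.
  move=> [dX <-] i j; rewrite derive_mx // mxE; apply: derivableP.
  exact: (derivable_mxP _ _ _).1.
move=> dX; have cX : derivable X t 1.
  by apply/derivable_mxP => i j; have [] := dX i j.
apply: DeriveDef => //; rewrite derive_mx //; apply/matrixP => i j.
by rewrite mxE; have [] := dX i j.
Qed.

Lemma mder_quotient m n (X : R -> 'M[R]_(m, n)) t D :
  mder X t D <-> mcvg (0 : R)^' (fun h : R => h^-1 *: (X (h + t) - X t)) D.
Proof.
split=> h i j.
  have /is_derive_quotient := h i j.
  by under [in X in _ -> X]eq_fun do rewrite !mxE.
apply/is_derive_quotient; have := h i j.
by under [in X in X -> _]eq_fun do rewrite !mxE.
Qed.

Lemma mder_cvg m n (X : R -> 'M[R]_(m, n)) t D :
  mder X t D -> mcvg (nbhs t) X (X t).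
Proof.
move=> h i j; have [/derivable1_diffP/differentiable_continuous c _] := h i j.
exact: c.
Qed.

Lemma cvg_dnbhs_shift (T : topologicalType) (f : R -> T) t (l : T) :
  f @ t --> l -> f (h + t) @[h --> 0^'] --> l.
Proof.
move=> fl; apply: cvg_trans fl => P /= fP.
have : \forall h \near (0 : R), P (f (h + t)).
  have : (h + t) @[h --> (0 : R)] --> t.
    by rewrite -[X in _ --> X]add0r; apply: cvgD; [exact: cvg_id | exact: cvg_cst].
  by move=> /(_ (f @^-1` P)); apply.
by move=> h; apply: nbhs_dnbhs h.
Qed.

Lemma mder_cvg_shift m n (X : R -> 'M[R]_(m, n)) t D :
  mder X t D -> mcvg (0 : R)^' (fun h : R => X (h + t)) (X t).
Proof.
by move=> /mder_cvg c i j; apply: (@cvg_dnbhs_shift _ (fun s => X s i j)); exact: c.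
Qed.

Lemma mder_eq m n (X : R -> 'M[R]_(m, n)) t D D' :
  mder X t D -> D = D' -> mder X t D'.
Proof. by move=> h <-. Qed.

Lemma mder_cst m n (X : 'M[R]_(m, n)) t : mder (fun=> X) t 0.
Proof. by move=> i j; rewrite mxE; exact: is_derive_cst. Qed.

Lemma mderD m n (X Y : R -> 'M[R]_(m, n)) t D E :
  mder X t D -> mder Y t E -> mder (fun s => X s + Y s) t (D + E).
Proof.
move=> /mder_quotient dX /mder_quotient dY; apply/mder_quotient.
by apply: mcvg_eq (mcvgD dX dY) => h; rewrite -scalerDr opprD addrACA.
Qed.

Lemma mderN m n (X : R -> 'M[R]_(m, n)) t D :
  mder X t D -> mder (fun s => - X s) t (- D).
Proof.
move=> /mder_quotient dX; apply/mder_quotient.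
by apply: mcvg_eq (mcvgN dX) => h; rewrite -scalerN opprB opprK addrC.
Qed.

Lemma mderB m n (X Y : R -> 'M[R]_(m, n)) t D E :
  mder X t D -> mder Y t E -> mder (fun s => X s - Y s) t (D - E).
Proof. by move=> dX dY; exact: mderD dX (mderN dY). Qed.

Lemma mderM m n p (X : R -> 'M[R]_(m, n)) (Y : R -> 'M[R]_(n, p)) t D E :
  mder X t D -> mder Y t E -> mder (fun s => X s *m Y s) t (D *m Y t + X t *m E).
Proof.
move=> dX dY; have cY := mder_cvg_shift dY.
move: dX dY => /mder_quotient dX /mder_quotient dY; apply/mder_quotient.
have dXY : mcvg (0 : R)^' (fun h : R => (h^-1 *: (X (h + t) - X t)) *m Y (h + t)
    + X t *m (h^-1 *: (Y (h + t) - Y t))) (D *m Y t + X t *m E).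
  by apply: mcvgD; apply: mcvgM => //; exact: mcvg_cst.
apply: mcvg_eq dXY => h.
rewrite -scalemxAl -scalemxAr -scalerDr mulmxBl mulmxBr.
by rewrite addrA subrK.
Qed.

Lemma mder_tr m n (X : R -> 'M[R]_(m, n)) t D :
  mder X t D -> mder (fun s => (X s)^T) t D^T.
Proof.
move=> dX i j; rewrite mxE; have := dX j i.
by congr (is_derive _ _ _ _); apply/funext => s; rewrite mxE.
Qed.

Lemma mderMl m n p (K : 'M[R]_(m, n)) (Y : R -> 'M[R]_(n, p)) t E :
  mder Y t E -> mder (fun s => K *m Y s) t (K *m E).
Proof.
by move=> dY; apply: mder_eq (mderM (mder_cst K t) dY) _; rewrite mul0mx add0r.
Qed.

Lemma mderMr m n p (K : 'M[R]_(n, p)) (Y : R -> 'M[R]_(m, n)) t E :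
  mder Y t E -> mder (fun s => Y s *m K) t (E *m K).
Proof.
by move=> dY; apply: mder_eq (mderM dY (mder_cst K t)) _; rewrite mulmx0 addr0.
Qed.

(** N vanishes at t, and the increment of X Y^-1 from t to s is N(s) Y(s)^-1. Only the continuity of
    the inverse is then needed, not its derivative. *)
Lemma mder_mulmxV m n (X : R -> 'M[R]_(m, n)) (Y : R -> 'M[R]_n) t D E :
    Y t \in unitmx -> mder X t D -> mder Y t E ->
  mder (fun s => X s *m invmx (Y s)) t
       ((D - X t *m invmx (Y t) *m E) *m invmx (Y t)).
Proof.
move=> Yu dX dY; have cY := mder_cvg_shift dY.
pose N s := X s - X t *m invmx (Y t) *m Y s.
have /mder_quotient dN : mder N t (D - X t *m invmx (Y t) *m E).
  by apply: mderB => //; exact: mderMl.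
have N0 : N t = 0 by rewrite /N mulmxKV // subrr.
apply/mder_quotient.
move=> i j; apply: cvg_trans ((mcvgM dN (mcvg_inv Yu cY)) i j).
apply: near_eq_cvg; near=> h.
have Yhu : Y (h + t) \in unitmx by near: h; exact: near_unitmx cY.
by rewrite N0 subr0 /N -scalemxAl mulmxBl mulmxK.
Unshelve. all: by end_near. Qed.

Lemma is_derive_bf n (X : R -> 'M[R]_n) t D x y :
  mder X t D -> is_derive t 1 (fun s => bf (X s) x y) (bf D x y).
Proof. by move=> dX; exact: (mderMr y (mderMl x^T dX) 0 0). Qed.
End MatrixDerivative.

(** * Differentiability of the squared distance along two curves *)

Section DistanceDerivative.
Variable R : realType.

Lemma mcvg_bounded (T : Type) (F : set_system T) {FF : Filter F} m n
    (X : T -> 'M[R]_(m, n)) L : mcvg F X L ->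
  exists2 b, 1 <= b & \forall t \near F, forall i j, `|X t i j| <= b.
Proof.
move=> XL; exists (abs_sum L + 1); first by rewrite lerDr abs_sum_ge0.
apply: filter_forall => i; apply: filter_forall => j.
have /cvgrPdist_le/(_ 1 ltr01) := XL i j; apply: filterS => t h.
have Lij : `|L i j| <= abs_sum L.
  apply: le_trans (row_abs_sum L i); rewrite (bigD1 j) //= lerDl; exact: sumr_ge0.
have := ler_normB (L i j) (L i j - X t i j); rewrite subKr.
by lra.
Qed.

(** The basis V that diagonalises the pair at t need not depend continuously on t. Boundedness of K
    = U^-1 V and of its inverse suffices, and it holds because K K^T = U^-1 P2 U^-T and K^-T K^-1 =
    U^T P2^-1 U converge. *)
Lemma sqdist_expansion (T : Type) (F : set_system T) {FF : Filter F} n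
    (P1 P2 : T -> 'M[R]_n) (U : 'M[R]_n) (d : 'rV[R]_n) :
    U \in unitmx -> (forall i, 0 < d 0 i) ->
    mcvg F P1 (U *m diag_mx d *m U^T) -> mcvg F P2 (U *m U^T) ->
    (\forall t \near F, spd (P1 t)) -> (\forall t \near F, spd (P2 t)) ->
  let M t := invmx U *m (P1 t *m invmx (P2 t)) *m U in
  exists2 C, 0 <= C & \forall t \near F,
    `|sqdist (P1 t) (P2 t) - sqdist (U *m diag_mx d *m U^T) (U *m U^T)
      - \sum_i 2 * ln (d 0 i) / d 0 i * (M t i i - d 0 i)|
    <= C * abs_sum (M t - diag_mx d) ^+ 2.
Proof.
move=> Uu d0 cP1 cP2 sP1 sP2 M.
have UTu : U^T \in unitmx by rewrite unitmx_tr.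
have du : diag_mx d \in unitmx.
  by rewrite unitmxE det_diag unitfE; apply/prodf_neq0 => i _; rewrite gt_eqF.
have UUu : U *m U^T \in unitmx by rewrite unitmx_mul Uu.
have UdUu : U *m diag_mx d *m U^T \in unitmx by rewrite !unitmx_mul Uu du.
have ccst m k (X : 'M[R]_(m, k)) : mcvg F (fun=> X) X by exact: mcvg_cst.
have c1 : mcvg F (fun t => invmx U *m P2 t *m invmx U^T)
    (invmx U *m (U *m U^T) *m invmx U^T).
  by apply: mcvgM => //; exact: mcvgM.
have c2 : mcvg F (fun t => U^T *m invmx (P2 t) *m U)
    (U^T *m invmx (U *m U^T) *m U).
  by apply: mcvgM => //; apply: mcvgM => //; exact: mcvg_inv.
have c3 : mcvg F (fun t => invmx U *m (P2 t *m invmx (P1 t)) *m U)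
    (invmx U *m (U *m U^T *m invmx (U *m diag_mx d *m U^T)) *m U).
  apply: mcvgM => //; apply: mcvgM => //; apply: mcvgM => //.
  exact: mcvg_inv.
have [b1 b10 n1] := mcvg_bounded c1; have [b2 b20 n2] := mcvg_bounded c2.
have [b3 b30 n3] := mcvg_bounded c3.
have b0 : 0 < b1 + b2 + b3 by lra.
have [C C0 CP] := sqr_ln_spectrum_taylor d0 b0.
exists C => //; near=> t.
have sP1t : spd (P1 t) by near: t.
have sP2t : spd (P2 t) by near: t.
have [V [l [Vu P2E P1E]]] := simdiag (proj1 sP1t) sP2t.
have l0 i : 0 < l 0 i by apply: (pencil_spd Vu); rewrite -P1E.
have VTu : V^T \in unitmx by rewrite unitmx_tr.
pose K := invmx U *m V.
have Ku : K \in unitmx by rewrite unitmx_mul unitmx_inv Uu.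
have KV : invmx K = invmx V *m U.
  apply: (can_inj (mulKmx Ku)); rewrite mulmxV //.
  by rewrite /K mulmxA mulmxK // mulVmx.
have P2V : invmx (P2 t) = invmx V^T *m invmx V.
  rewrite P2E; have VV : V *m V^T \in unitmx by rewrite unitmx_mul Vu.
  apply: (can_inj (mulKmx VV)); rewrite mulmxV //.
  by rewrite mulmxA mulmxK // mulmxV.
have ME : M t = K *m diag_mx l *m invmx K.
  by rewrite /M P2V P1E KV /K !mulmxA mulmxK.
have K2 : K *m K^T = invmx U *m P2 t *m invmx U^T.
  by rewrite /K trmx_mul P2E trmx_inv !mulmxA.
have K2' : (invmx K)^T *m invmx K = U^T *m invmx (P2 t) *m U.
  by rewrite KV trmx_mul P2V trmx_inv !mulmxA.
clearbody K.
(* The square of an entry of K is at most a diagonal entry of K K^T; b >= 1 allows the same bound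
   without the square. *)
have sq_le (a b : R) : 1 <= b -> a ^+ 2 <= b -> `|a| <= b.
  move=> b1' ab; rewrite -ler_sqr ?nnegrE //; last by lra.
  by rewrite -normrX ger0_norm ?sqr_ge0 //; nra.
have n1t : forall i j, `|(invmx U *m P2 t *m invmx U^T) i j| <= b1 by near: t.
have n2t : forall i j, `|(U^T *m invmx (P2 t) *m U) i j| <= b2 by near: t.
have n3t : forall i j,
  `|(invmx U *m (P2 t *m invmx (P1 t)) *m U) i j| <= b3 by near: t.
have Kb i j : `|K i j| <= b1 + b2 + b3.
  apply: le_trans (_ : b1 <= _); last by lra.
  apply: sq_le => //; apply: le_trans (n1t i i); apply: le_trans (ler_norm _).
  rewrite -K2 mxE (bigD1 j) //= mxE -expr2 lerDl; apply: sumr_ge0 => k _.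
  by rewrite mxE -expr2 sqr_ge0.
have K'b i j : `|invmx K i j| <= b1 + b2 + b3.
  apply: le_trans (_ : b2 <= _); last by lra.
  apply: sq_le => //; apply: le_trans (n2t j j); apply: le_trans (ler_norm _).
  rewrite -K2' mxE (bigD1 i) //= mxE -expr2 lerDl; apply: sumr_ge0 => k _.
  by rewrite mxE -expr2 sqr_ge0.
have P1u := spd_unit sP1t; have P2u := spd_unit sP2t.
have MV : invmx (M t) = invmx U *m (P2 t *m invmx (P1 t)) *m U.
  have Mu : M t \in unitmx by rewrite !unitmx_mul !unitmx_inv Uu P1u P2u.
  apply: (can_inj (mulKmx Mu)); rewrite mulmxV // /M !mulmxA mulmxK //.
  by rewrite mulmxKV // mulmxK // mulVmx.
have M'b i j : `|invmx (M t) i j| <= b1 + b2 + b3.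
  by rewrite MV; apply: le_trans (n3t i j) _; lra.
have := CP K l Ku l0; rewrite -ME => /(_ Kb K'b M'b).
by rewrite P1E P2E !sqdist_pencil.
Unshelve. all: by end_near. Qed.

End DistanceDerivative.

Section SqdistDerivative.
Variable R : realType.

Lemma cvg_abs_sum (T : Type) (F : set_system T) {FF : Filter F} m n
    (X : T -> 'M[R]_(m, n)) L :
  mcvg F X L -> abs_sum (X t) @[t --> F] --> abs_sum L.
Proof.
move=> XL; apply: cvg_bigsum => i; apply: cvg_bigsum => j.
by apply: cvg_norm; exact: XL.
Qed.

Lemma abs_sum0 m n : abs_sum (0 : 'M[R]_(m, n)) = 0.
Proof.
by rewrite /abs_sum; apply: big1 => i _; apply: big1 => j _; rewrite mxE normr0.
Qed.

Lemma squeeze_abs0 (T : Type) (F : set_system T) {FF : ProperFilter F}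
    (f e : T -> R) : (\forall t \near F, `|f t| <= e t) ->
  e t @[t --> F] --> 0 -> f t @[t --> F] --> 0.
Proof.
move=> fe e0; apply: (@squeeze_cvgr _ _ _ _ (fun t => - e t) e) => //.
- by apply: filterS fe => t; rewrite ler_norml.
- by rewrite -oppr0; exact: cvgN.
Qed.

Lemma sqdist_cvg (T : Type) (F : set_system T) {FF : ProperFilter F} n
    (P1 P2 : T -> 'M[R]_n) (Q1 Q2 : 'M[R]_n) :
    spd Q1 -> spd Q2 -> mcvg F P1 Q1 -> mcvg F P2 Q2 ->
    (\forall t \near F, spd (P1 t)) -> (\forall t \near F, spd (P2 t)) ->
  sqdist (P1 t) (P2 t) @[t --> F] --> sqdist Q1 Q2.
Proof.
move=> Q1pd Q2pd c1 c2 s1 s2.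
have [U [d [Uu Q2E Q1E]]] := simdiag (proj1 Q1pd) Q2pd.
have d0 i : 0 < d 0 i by apply: (pencil_spd Uu); rewrite -Q1E.
have Q2u := spd_unit Q2pd.
have c1' : mcvg F P1 (U *m diag_mx d *m U^T) by rewrite -Q1E.
have c2' : mcvg F P2 (U *m U^T) by rewrite -Q2E.
have [C C0] := sqdist_expansion Uu d0 c1' c2' s1 s2.
rewrite -Q1E -Q2E => hC.
pose M t := invmx U *m (P1 t *m invmx (P2 t)) *m U.
have UTu : U^T \in unitmx by rewrite unitmx_tr.
have cM : mcvg F M (diag_mx d).
  have -> : diag_mx d = invmx U *m (Q1 *m invmx Q2) *m U.
    have -> : Q1 *m invmx Q2 = U *m diag_mx d *m invmx U.
      apply: (can_inj (mulmxK Q2u)); rewrite mulmxKV // Q2E mulmxA mulmxKV //.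
    by rewrite !mulmxA mulVmx // mul1mx mulmxKV.
  apply: mcvgM; last exact: mcvg_cst; apply: mcvgM; first exact: mcvg_cst.
  by apply: mcvgM => //; exact: mcvg_inv.
have cE : abs_sum (M t - diag_mx d) @[t --> F] --> 0.
  rewrite -(abs_sum0 n n) -(subrr (diag_mx d)); apply: cvg_abs_sum.
  by apply: mcvgB => //; exact: mcvg_cst.
pose phi t := \sum_i 2 * ln (d 0 i) / d 0 i * (M t i i - d 0 i).
have cphi : phi t @[t --> F] --> 0.
  have -> : 0 = \sum_(i < n) 2 * ln (d 0 i) / d 0 i * (d 0 i - d 0 i).
    by rewrite big1 // => i _; rewrite subrr mulr0.
  apply: cvg_bigsum => i; apply: cvgM; first exact: cvg_cst.
  apply: cvgB; last exact: cvg_cst.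
  by have := cM i i; rewrite mxE eqxx mulr1n.
have cerr : C * abs_sum (M t - diag_mx d) ^+ 2 @[t --> F] --> 0.
  have -> : 0 = C * (0 * 0) :> R by rewrite !mulr0.
  by apply: cvgM; [exact: cvg_cst | exact: cvgM].
have h0 : sqdist (P1 t) (P2 t) - sqdist Q1 Q2 - phi t @[t --> F] --> 0.
  exact: squeeze_abs0 hC cerr.
have -> : sqdist Q1 Q2 = 0 + 0 + sqdist Q1 Q2 by rewrite !add0r.
have -> : (fun t => sqdist (P1 t) (P2 t)) = (fun t =>
    (sqdist (P1 t) (P2 t) - sqdist Q1 Q2 - phi t) + phi t + sqdist Q1 Q2).
  by apply/funext => t; rewrite subrK subrK.
apply: cvgD; last exact: cvg_cst.
exact: (cvgD h0 cphi).
Qed.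

(** Only the linear term of [sqdist_expansion] survives in the difference quotient, and the
    derivative of the i-th diagonal entry of M is D1 - d_i D2 evaluated at v_i. The d_i may be
    repeated. *)
Lemma sqdist_derive n (P1 P2 : R -> 'M[R]_n) (D1 D2 U : 'M[R]_n) (d : 'rV[R]_n) t :
    U \in unitmx -> (forall i, 0 < d 0 i) ->
    P1 t = U *m diag_mx d *m U^T -> P2 t = U *m U^T ->
    (\forall s \near t, spd (P1 s)) -> (\forall s \near t, spd (P2 s)) ->
    mder P1 t D1 -> mder P2 t D2 ->
  let v i := invmx U^T *m delta_mx i 0 in
  is_derive t 1 (fun s => sqdist (P1 s) (P2 s))
    (\sum_i 2 * ln (d 0 i) / d 0 i * bf (D1 - d 0 i *: D2) (v i) (v i)).
Proof.
move=> Uu d0 P1E P2E s1 s2 dP1 dP2 v.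
have UTu : U^T \in unitmx by rewrite unitmx_tr.
have UUu : U *m U^T \in unitmx by rewrite unitmx_mul Uu.
have P2u : P2 t \in unitmx by rewrite P2E.
have c1 := mder_cvg_shift dP1; have c2 := mder_cvg_shift dP2.
have sh : (h + t) @[h --> (0 : R)^'] --> t.
  by apply: (@cvg_dnbhs_shift R R id); exact: cvg_id.
have s1' : \forall h \near (0 : R)^', spd (P1 (h + t)).
  exact: (sh _ s1).
have s2' : \forall h \near (0 : R)^', spd (P2 (h + t)).
  exact: (sh _ s2).
rewrite P1E in c1; rewrite P2E in c2.
have [C C0] := sqdist_expansion Uu d0 c1 c2 s1' s2'.
pose M s := invmx U *m (P1 s *m invmx (P2 s)) *m U.
rewrite -P1E -P2E => hC.
have PU : P1 t *m invmx (P2 t) = U *m diag_mx d *m invmx U.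
  apply: (can_inj (mulmxK P2u)); rewrite mulmxKV // P1E P2E.
  by rewrite !mulmxA mulmxKV.
have Mt : M t = diag_mx d by rewrite /M PU !mulmxA mulVmx // mul1mx mulmxKV.
pose DM := invmx U *m ((D1 - U *m diag_mx d *m invmx U *m D2) *m invmx (P2 t)) *m U.
have dM : mder M t DM.
  by apply: mderMr; apply: mderMl; rewrite -PU; exact: mder_mulmxV.
have DMii i : DM i i = bf (D1 - d 0 i *: D2) (v i) (v i).
  have P2V : invmx (P2 t) *m U = invmx U^T.
    apply: (can_inj (mulKmx P2u)); rewrite mulmxA mulmxV // mul1mx P2E.
    by rewrite mulmxK.
  have -> : DM = invmx U *m D1 *m invmx U^T
      - diag_mx d *m (invmx U *m D2 *m invmx U^T).
    rewrite /DM -!mulmxA P2V !mulmxBl !mulmxBr !mulmxA mulVmx //.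
    by rewrite mul1mx.
  have vD (D : 'M[R]_n) : (invmx U *m D *m invmx U^T) i i = bf D (v i) (v i).
    by rewrite -bf_congr trmx_inv trmxK bf_delta.
  by rewrite addmxE oppmxE vD mul_diag_mx mxE vD bfB bfZ.
have qM := (mder_quotient M t DM).1 dM.
apply/is_derive_quotient.
pose phi s := \sum_i 2 * ln (d 0 i) / d 0 i * (M s i i - d 0 i).
have cphi : h^-1 * phi (h + t) @[h --> (0 : R)^'] -->
    \sum_i 2 * ln (d 0 i) / d 0 i * bf (D1 - d 0 i *: D2) (v i) (v i).
  have -> : (fun h => h^-1 * phi (h + t)) = (fun h =>
      \sum_i 2 * ln (d 0 i) / d 0 i * (h^-1 *: (M (h + t) - M t)) i i).
    apply/funext => h; rewrite /phi mulr_sumr; apply: eq_bigr => i _.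
    by rewrite Mt scalemxE addmxE oppmxE [diag_mx d i i]mxE eqxx mulr1n mulrCA.
  apply: cvg_bigsum => i; apply: cvgM; first exact: cvg_cst.
  by rewrite -DMii; exact: qM.
have cE : abs_sum (M (h + t) - M t) @[h --> (0 : R)^'] --> 0.
  rewrite -[X in _ --> X](abs_sum0 n n) -(subrr (M t)); apply: cvg_abs_sum.
  by apply: mcvgB; [exact: mder_cvg_shift dM | exact: mcvg_cst].
have cqE : abs_sum (h^-1 *: (M (h + t) - M t)) @[h --> (0 : R)^'] --> abs_sum DM.
  exact: cvg_abs_sum qM.
(* The quadratic error divided by h is a convergent quotient times an increment that tends to 0. *)
have cerr : C * (abs_sum (h^-1 *: (M (h + t) - M t)) * abs_sum (M (h + t) - M t))
    @[h --> (0 : R)^'] --> 0.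
  have e0 : C * (abs_sum DM * 0) = 0 by rewrite !mulr0.
  rewrite -[X in _ --> X]e0.
  by apply: cvgM; [exact: cvg_cst | exact: cvgM].
have h0 : h^-1 * (sqdist (P1 (h + t)) (P2 (h + t)) - sqdist (P1 t) (P2 t)
    - phi (h + t)) @[h --> (0 : R)^'] --> 0.
  apply: squeeze_abs0 cerr; apply: filterS hC => h hC.
  rewrite normrM; apply: le_trans (ler_wpM2l (normr_ge0 _) hC) _.
  have -> : abs_sum (h^-1 *: (M (h + t) - M t)) = `|h^-1| * abs_sum (M (h + t) - M t).
    rewrite /abs_sum mulr_sumr; apply: eq_bigr => i _; rewrite mulr_sumr.
    by apply: eq_bigr => j _; rewrite scalemxE normrM.
  by rewrite -Mt -/(M _) le_eqVlt; apply/orP; left; apply/eqP; ring.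
rewrite -[X in _ --> X]add0r.
have -> : (fun h => h^-1 * (sqdist (P1 (h + t)) (P2 (h + t)) - sqdist (P1 t) (P2 t)))
  = (fun h => h^-1 * (sqdist (P1 (h + t)) (P2 (h + t)) - sqdist (P1 t) (P2 t)
    - phi (h + t)) + h^-1 * phi (h + t)).
  by apply/funext => h; rewrite -mulrDr subrK.
exact: (cvgD h0 cphi).
Qed.
End SqdistDerivative.

(** * Dissipation and contraction *)

Section Contraction.
Variable R : realType.

(** One hypothesis serves each sign of ln d: c d <= w with ln d <= d - 1 when d >= 1, and c <= w
    with - ln d <= 1 / d - 1 when d < 1. They come from W >= c P1 and W >= c P2 at a vector where
    the two forms take the values d and 1. *)
Lemma ln_dissipation (c d w : R) : 0 < d -> 0 <= c -> c <= w -> c * d <= w ->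
  2 * ln d / d * ((1 - d) * w) <= - (2 * c) * ln d ^+ 2.
Proof.
move=> d0 c0 cw cdw; set l := ln d.
have ld : l <= d - 1 by have := @le_ln1Dx R (d - 1); rewrite subrKC; apply; lra.
have lV : - l <= d^-1 - 1.
  have dV0 : 0 < d^-1 by rewrite invr_gt0.
  by have := @le_ln1Dx R (d^-1 - 1); rewrite subrKC lnV ?posrE //; apply; lra.
have -> : 2 * l / d * ((1 - d) * w) = 2 * (l * (d^-1 - 1) * w).
  by field; rewrite gt_eqF.
have -> : - (2 * c) * l ^+ 2 = 2 * (- (c * (l * l))) by ring.
rewrite ler_pM2l //.
have [l0|l0] := lerP 0 l.
  have wd : c <= w / d by rewrite ler_pdivlMr.
  have -> : l * (d^-1 - 1) * w = - (l * (d - 1) * (w / d)) by field; rewrite gt_eqF.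
  rewrite lerN2 mulrC; apply: ler_pM => //; first exact: mulr_ge0.
  exact: ler_wpM2l.
have -> : l * (d^-1 - 1) * w = - (- l * (d^-1 - 1) * w) by ring.
rewrite lerN2 mulrC; apply: ler_pM => //; first by nra.
by rewrite -mulrNN; apply: ler_wpM2l => //; lra.
Qed.

(** Integrating factor exp (- k s). At 0 only right-continuity is assumed, which is what [solution]
    provides. *)
Lemma gronwall (g : R -> R) (k t : R) : 0 < t ->
    g s @[s --> (0 : R)^'+] --> g 0 ->
    (forall s : R, 0 < s -> s <= t ->
      exists2 D, is_derive s 1 g D & D <= k * g s) ->
  g t <= expR (k * t) * g 0.
Proof.
move=> t0 cg0 dg; pose e (s : R) := expR (- k * s).
have de (s : R) : is_derive s 1 e (- k * e s).
  have dl : is_derive s 1 (fun r : R => - k * r) (- k).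
    apply/is_derive_quotient; apply: cvg_near_cst; near=> h.
    have h0 : h != 0 by near: h; exact: nbhs_dnbhs_neq.
    by field.
  have h := is_derive1_comp (is_derive_expR (- k * s)) dl.
  by apply: (is_derive_eq h); rewrite mulrC.
pose h (s : R) := g s * e s.
have dh (s : R) : 0 < s -> s <= t -> exists2 D, is_derive s 1 h D & D <= 0.
  move=> s0 st; have [D gD Dle] := dg s s0 st.
  exists (g s *: (- k * e s) + e s *: D); first exact: is_deriveM.
  rewrite /GRing.scale /=; have : 0 < e s by exact: expR_gt0.
  by nra.
have ch : {within `[0, t], continuous h}.
  apply/continuous_within_itvP => //.
  have cs (s : R) : 0 < s -> s <= t -> h @ s --> h s.
    move=> s0 st; have [D [/derivable1_diffP/differentiable_continuous hc _] _] := dh s s0 st.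
    exact: hc.
  split.
  - by move=> s; rewrite in_itv /= => /andP[s0 /ltW]; exact: cs.
  - have ce : e s @[s --> (0 : R)^'+] --> e 0.
      apply: cvg_at_right_filter; have [/derivable1_diffP h0 _] := de 0.
      exact: differentiable_continuous h0.
    exact: cvgM.
  - by apply: cvg_at_left_filter; exact: cs.
have hle : h t <= h 0.
  apply: (ler0_derive1_le_cc _ _ ch); rewrite ?in_itv /= ?lexx ?ltW //.
    move=> s; rewrite in_itv /= => /andP[s0 /ltW st].
    by have [D [? _] _] := dh s s0 st.
  move=> s; rewrite in_itv /= => /andP[s0 /ltW st].
  by have [D [_ DE] D0] := dh s s0 st; rewrite derive1E DE.
move: hle; rewrite /h /e mulr0 expR0 mulr1 mulNr expRN.
by rewrite mulrC ler_pdivrMl ?expR_gt0.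
Unshelve. all: by end_near. Qed.

Variables (n : nat) (A W S : 'M[R]_n).
Hypotheses (Sp : psd S).
Let Phi := ric A W S.

Lemma sqdist_dissipation (P1 P2 U : 'M[R]_n) (d : 'rV[R]_n) (c : R) :
    U \in unitmx -> (forall i, 0 < d 0 i) ->
    P1 = U *m diag_mx d *m U^T -> P2 = U *m U^T -> spd P1 -> spd P2 -> 0 <= c ->
    (forall x, c * bf P1 x x <= bf W x x) -> (forall x, c * bf P2 x x <= bf W x x) ->
  \sum_i 2 * ln (d 0 i) / d 0 i * bf (Phi P1 - d 0 i *: Phi P2)
      (invmx U^T *m delta_mx i 0) (invmx U^T *m delta_mx i 0)
    <= - (2 * c) * sqdist P1 P2.
Proof.
move=> Uu d0 P1E P2E P1pd P2pd c0 c1 c2.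
pose v i := invmx U^T *m delta_mx i 0 : 'cV[R]_n.
have -> : sqdist P1 P2 = \sum_i ln (d 0 i) ^+ 2 by rewrite P1E P2E sqdist_pencil.
rewrite mulr_sumr; apply: ler_sum => i _; rewrite -/(v i).
have [vE v1 _] := pencil_vector d i Uu.
rewrite -P1E -P2E in vE v1.
rewrite (ric_pencil _ _ _ (proj1 P1pd) (proj1 P2pd) vE).
apply: ln_dissipation => //.
  apply: le_trans (_ : bf W (v i) (v i) <= _); last first.
    by rewrite lerDl mulr_ge0 // ltW.
  by have := c2 (v i); rewrite v1 mulr1.
apply: le_trans (_ : bf W (v i) (v i) <= _); last first.
  by rewrite lerDl mulr_ge0 // ltW.
have := c1 (v i); rewrite {1}/bf -mulmxA vE -scalemxAr mxE.
by rewrite mulmxA -/(bf _ _ _) v1 mulr1.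
Qed.

Definition global_spd_solution (P : R -> 'M[R]_n) :=
  [/\ mcvg (0 : R)^'+ P (P 0), forall t : R, 0 <= t -> spd (P t) &
      forall t : R, 0 < t -> mder P t (Phi (P t))].

Lemma contraction P1 P2 (c : R) :
    global_spd_solution P1 -> global_spd_solution P2 -> 0 <= c ->
    (forall t : R, 0 < t -> forall x, c * bf (P1 t) x x <= bf W x x) ->
    (forall t : R, 0 < t -> forall x, c * bf (P2 t) x x <= bf W x x) ->
  forall t : R, 0 <= t ->
    sqdist (P1 t) (P2 t) <= expR (- (2 * c) * t) * sqdist (P1 0) (P2 0).
Proof.
move=> [r1 s1 d1] [r2 s2 d2] c0 c1 c2 t; rewrite le_eqVlt => /predU1P[<-|t0].
  by rewrite mulr0 expR0 mul1r.
have near_spd (P : R -> 'M[R]_n) (s : R) : 0 < s -> (forall t : R, 0 <= t -> spd (P t)) ->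
    \forall r \near s, spd (P r).
  move=> s0 Ps; have := lt_nbhsr s0; apply: filterS => r r0.
  by apply: Ps; exact: ltW.
pose g (s : R) := sqdist (P1 s) (P2 s).
have dg (s : R) : 0 < s -> exists2 D, is_derive s 1 g D & D <= - (2 * c) * g s.
  move=> s0; have P1s := s1 s (ltW s0); have P2s := s2 s (ltW s0).
  (* The basis is chosen anew at each time s, with no regularity in s. *)
  have [U [d [Uu P2E P1E]]] := simdiag (proj1 P1s) P2s.
  have dd0 i : 0 < d 0 i by apply: (pencil_spd Uu); rewrite -P1E.
  eexists.
    exact: (sqdist_derive Uu dd0 P1E P2E (near_spd _ _ s0 s1) (near_spd _ _ s0 s2)
      (d1 s s0) (d2 s s0)).
  by apply: sqdist_dissipation => //; [exact: c1 | exact: c2].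
apply: (@gronwall g) => //; last by move=> s s0 _; exact: dg.
apply: sqdist_cvg => //; [exact: s1 | exact: s2 | |].
  by near=> s; apply: s1; near: s; exact: nbhs_right_ge.
by near=> s; apply: s2; near: s; exact: nbhs_right_ge.
Unshelve. all: by end_near. Qed.
End Contraction.

(** * Global solutions of the Riccati flow *)

Section MatrixExponential.
Variables (R : realType) (n : nat) (M : 'M[R]_n).

(** Taylor coefficients of an entry of N exp (t M). Carrying the left factor N closes the family
    under differentiation, which replaces N by N M. *)
Definition expm_coef m (N : 'M[R]_(m, n)) i j (k : nat) : R :=
  (N *m M ^+ k) i j / k`!%:R.

Definition expm m (N : 'M[R]_(m, n)) (t : R) : 'M[R]_(m, n) :=
  \matrix_(i, j) limn (pseries (expm_coef N i j) t).

Lemma expm_coef_bound m (N : 'M[R]_(m, n)) i j k :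
  `|expm_coef N i j k| <= abs_sum N * ((abs_sum M + 1) ^+ k / k`!%:R).
Proof.
set B := abs_sum M + 1.
have B0 : 0 <= B by rewrite addr_ge0 // abs_sum_ge0.
have Mk l p : `|(M ^+ k) l p| <= B ^+ k.
  elim: k l => [|k IH] l.
    by rewrite !expr0 mxE; case: eqP; rewrite ?normr1 ?normr0.
  rewrite !exprS -mulmxE; apply: le_trans (mulmx_entry_le _ _ (fun q => IH q)) _.
  rewrite ler_wpM2r ?exprn_ge0 //; apply: le_trans (row_abs_sum M l) _.
  by rewrite lerDl.
rewrite /expm_coef normrM [`|_^-1|]ger0_norm ?invr_ge0 // mulrA.
rewrite ler_wpM2r ?invr_ge0 //.
apply: le_trans (mulmx_entry_le _ _ (fun q => Mk q j)) _.
by rewrite ler_wpM2r ?exprn_ge0 ?row_abs_sum.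
Qed.

Lemma is_cvg_expm m (N : 'M[R]_(m, n)) i j t :
  cvgn (pseries (expm_coef N i j) t).
Proof.
apply: normed_cvg; rewrite /normed_series_of /=.
pose b k := abs_sum N * exp_coeff ((abs_sum M + 1) * `|t|) k.
apply: (@series_le_cvg _ _ b) => [//=|k|k|].
- by rewrite mulr_ge0 ?abs_sum_ge0 // exp_coeff_ge0 // mulr_ge0 // addr_ge0 // abs_sum_ge0.
- rewrite normrM normrX /b /exp_coeff /= exprMn.
  have -> : abs_sum N * ((abs_sum M + 1) ^+ k * `|t| ^+ k / k`!%:R) =
    abs_sum N * ((abs_sum M + 1) ^+ k / k`!%:R) * `|t| ^+ k by ring.
  by rewrite ler_wpM2r ?exprn_ge0 // expm_coef_bound.
- have -> : [series b k]_k = (fun p => abs_sum N *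
      [series exp_coeff ((abs_sum M + 1) * `|t|) k]_k p).
    by apply/funext => p; rewrite /series /= mulr_sumr.
  by apply: is_cvgMr; exact: is_cvg_series_exp_coeff.
Qed.

Lemma expm_diffs m (N : 'M[R]_(m, n)) i j :
  pseries_diffs (expm_coef N i j) = expm_coef (N *m M) i j.
Proof.
apply/funext => k; rewrite /pseries_diffs /expm_coef exprS -mulmxE mulmxA.
by rewrite factS natrM invfM mulrCA (mulrA k.+1%:R) mulfV ?mul1r ?pnatr_eq0.
Qed.

Lemma expm_mulmx m p (K : 'M[R]_(p, m)) (N : 'M[R]_(m, n)) t :
  expm (K *m N) t = K *m expm N t.
Proof.
apply/matrixP => i j; rewrite !mxE.
have h : (fun q => \sum_k K i k * pseries (expm_coef N k j) t q) @ \oo -->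
    \sum_k K i k * expm N t k j.
  apply: cvg_bigsum => k; rewrite mxE.
  exact: (cvgM (cvg_cst (K i k)) (is_cvg_expm (t := t))).
have -> : pseries (expm_coef (K *m N) i j) t =
    (fun q => \sum_k K i k * pseries (expm_coef N k j) t q); last exact: cvg_lim h.
apply/funext => q.
rewrite /pseries /series /=; under [RHS]eq_bigr do rewrite mulr_sumr.
rewrite exchange_big; apply: eq_bigr => k _.
rewrite /expm_coef -mulmxA mxE !mulr_suml; apply: eq_bigr => l _.
by rewrite !mulrA.
Qed.

Lemma mder_expm t : mder (expm 1%:M) t (M *m expm 1%:M t).
Proof.
move=> i j; rewrite -expm_mulmx mulmx1 !mxE -[M in expm_coef M]mul1mx -expm_diffs.
have -> : (fun s => expm 1%:M s i j) =
    (fun s => limn (pseries (expm_coef 1%:M i j) s)).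
  by apply/funext => s; rewrite mxE.
apply: (@pseries_snd_diffs _ _ (`|t| + 1)).
- exact: is_cvg_expm.
- by rewrite expm_diffs; exact: is_cvg_expm.
- by rewrite !expm_diffs; exact: is_cvg_expm.
- by rewrite [ltRHS]ger0_norm ?ltrDl // addr_ge0.
Qed.

Lemma expm0 : expm 1%:M 0 = 1%:M.
Proof.
apply/matrixP => i j; rewrite mxE; apply/cvg_lim => //.
apply: cvg_near_cst; near=> k.
have k0 : (0 < k)%N by near: k; exact: nbhs_infty_gt.
rewrite /pseries /series /= -(prednK k0) big_nat_recl //= big1 => [|l _].
  by rewrite addr0 /expm_coef expr0 mulmx1 fact0 divr1 mulr1.
by rewrite expr0n mulr0.
Unshelve. all: by end_near. Qed.
End MatrixExponential.

(** * The Hamiltonian system and its Riccati quotient *)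

Section HamiltonianFlow.
Variables (R : realType) (n : nat) (A W S : 'M[R]_n).
Hypotheses (Wpd : spd W) (Ss : S^T = S) (Sp : psd S).

Lemma hamiltonian_flow (P0 : 'M[R]_n) : exists X Y : R -> 'M[R]_n,
  [/\ X 0 = P0, Y 0 = 1%:M,
      forall t, mder X t (A *m X t + W *m Y t) &
      forall t, mder Y t (S *m X t - A^T *m Y t)].
Proof.
pose H : 'M[R]_(n + n) := block_mx A W S (- A^T).
pose Z t := expm H 1%:M t *m col_mx P0 1%:M.
have dZ t : mder Z t (H *m Z t).
  have -> : H *m Z t = (H *m expm H 1%:M t) *m col_mx P0 1%:M by rewrite mulmxA.
  by apply: mderMr; exact: mder_expm.
exists (fun t => usubmx (Z t)), (fun t => dsubmx (Z t)).
have Z0 : Z 0 = col_mx P0 1%:M by rewrite /Z expm0 mul1mx.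
have HZ t : H *m Z t = col_mx (A *m usubmx (Z t) + W *m dsubmx (Z t))
    (S *m usubmx (Z t) - A^T *m dsubmx (Z t)).
  by rewrite -{1}[Z t]vsubmxK mul_block_col mulNmx.
split; first by rewrite Z0 col_mxKu.
- by rewrite Z0 col_mxKd.
- move=> t i j.
  have -> : (fun s => usubmx (Z s) i j) = (fun s => Z s (lshift n i) j).
    by apply/funext => s; rewrite mxE.
  by have := dZ t (lshift n i) j; rewrite HZ col_mxEu.
- move=> t i j.
  have -> : (fun s => dsubmx (Z s) i j) = (fun s => Z s (rshift n i) j).
    by apply/funext => s; rewrite mxE.
  by have := dZ t (rshift n i) j; rewrite HZ col_mxEd.
Qed.

Lemma mder0_cst m k (X : R -> 'M[R]_(m, k)) s t : 
  (forall r, mder X r 0) -> X s = X t.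
Proof.
move=> dX; apply/matrixP => i j.
apply: (@is_derive_0_is_cst _ (fun r => X r i j)) => r.
by have := dX r i j; rewrite mxE.
Qed.

Lemma unitmx_ker0 (Y : 'M[R]_n) :
  (forall x : 'cV[R]_n, Y *m x = 0 -> x = 0) -> Y \in unitmx.
Proof.
move=> Yi; rewrite -unitmx_tr unitmxE unitfE; apply/negP => /det0P[v v0 vY].
move/negP: v0; apply; apply/eqP/trmx_inj; rewrite trmx0; apply: Yi.
by apply: trmx_inj; rewrite trmx_mul trmxK trmx0.
Qed.

(* Along the flow, (Y^T X)' = Y^T W Y + X^T S X >= 0. *)
Lemma hamiltonian_flow_spd (X Y : R -> 'M[R]_n) : spd (X 0) -> Y 0 = 1%:M ->
    (forall t, mder X t (A *m X t + W *m Y t)) ->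
    (forall t, mder Y t (S *m X t - A^T *m Y t)) ->
  forall t : R, 0 <= t -> Y t \in unitmx /\ spd (X t *m invmx (Y t)).
Proof.
move=> X0pd Y0 dX dY t t0; have [Ws _] := Wpd.
pose N s := (Y s)^T *m X s.
pose DN s := (Y s)^T *m W *m Y s + (X s)^T *m S *m X s.
have dN s : mder N s (DN s).
  apply: mder_eq (mderM (mder_tr (dY s)) (dX s)) _.
  rewrite /DN linearB /= !trmx_mul trmxK Ss.
  by mxring.
have dNT s : mder (fun r => (N r)^T) s (DN s).
  apply: mder_eq (mder_tr (dN s)) _.
  by rewrite /DN linearD /= !trmx_mul !trmxK Ss Ws !mulmxA.
have N0 : N 0 = X 0 by rewrite /N Y0 trmx1 mul1mx.
(* Y^T X and its transpose have the same derivative and the same symmetric initial value. *)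
have Ns s : (N s)^T = N s.
  apply/eqP; rewrite -subr_eq0; apply/eqP.
  rewrite (mder0_cst (X := fun r => (N r)^T - N r) s 0).
    by rewrite N0 (proj1 X0pd) subrr.
  by move=> r; apply: mder_eq (mderB (dNT r) (dN r)) _; rewrite subrr.
have Nge x : bf (X 0) x x <= bf (N t) x x.
  rewrite -N0; have dbf s := is_derive_bf x x (dN s).
  apply: (ger0_derive1_le_cc (f := fun s => bf (N s) x x) (a := 0) (b := t)).
  - by move=> s _; have [] := dbf s.
  - move=> s _; have [_ E] := dbf s; rewrite derive1E E /DN bfD !bf_congr.
    by rewrite addr_ge0 // spd_psd.
  - apply: continuous_subspaceT => s.
    by have [/derivable1_diffP/differentiable_continuous] := dbf s.
  - by rewrite in_itv /= lexx.
  - by rewrite in_itv /= t0 lexx.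
  - exact: t0.
have Npd : spd (N t).
  split => // x x0; apply: lt_le_trans (Nge x); exact: (proj2 X0pd).
have Yu : Y t \in unitmx.
  apply: unitmx_ker0 => x Yx; apply/eqP; apply: contraT => x0.
  have := proj2 Npd _ x0; rewrite -/(bf _ _ _) /N bf_trmulmx Yx.
  by rewrite /bf trmx0 !mul0mx mxE ltxx.
split => //.
(* The quotient is congruent to Y^T X through Y^-1. *)
have -> : X t *m invmx (Y t) = (invmx (Y t))^T *m N t *m invmx (Y t).
  by rewrite /N mulmxA -trmx_mul mulmxV // trmx1 mul1mx.
by apply: spd_congr => // x; apply: unitmx_inj0; rewrite unitmx_inv.
Qed.

Lemma flow_riccati (X Y : R -> 'M[R]_n) t : Y t \in unitmx ->
    mder X t (A *m X t + W *m Y t) -> mder Y t (S *m X t - A^T *m Y t) ->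
  mder (fun s => X s *m invmx (Y s)) t (ric A W S (X t *m invmx (Y t))).
Proof.
move=> Yu dX dY; apply: mder_eq (mder_mulmxV Yu dX dY) _.
rewrite /ric !mxexpand !(mulmxK Yu).
by mxring.
Qed.

Lemma is_derive_bigsum (I : Type) (r : seq I) (f : I -> R -> R) (D : I -> R) (t : R) :
  (forall i, is_derive t 1 (f i) (D i)) ->
  is_derive t 1 (fun s => \sum_(i <- r) f i s) (\sum_(i <- r) D i).
Proof.
move=> df; apply/is_derive_quotient.
have -> : (fun h => h^-1 * (\sum_(i <- r) f i (h + t) - \sum_(i <- r) f i t)) =
    (fun h => \sum_(i <- r) h^-1 * (f i (h + t) - f i t)).
  by apply/funext => h; rewrite -mulr_sumr -sumrB.
by apply: cvg_bigsum => i; apply/is_derive_quotient.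
Qed.

(* X - P Y solves the linear equation Z' = (A - P S) Z with Z(0) = 0. *)
Lemma riccati_flow_unique (X Y P : R -> 'M[R]_n) (T : R) : 0 < T ->
    X 0 = P 0 -> Y 0 = 1%:M ->
    (forall t, mder X t (A *m X t + W *m Y t)) ->
    (forall t, mder Y t (S *m X t - A^T *m Y t)) ->
    mcvg (0 : R)^'+ P (P 0) ->
    (forall t : R, 0 < t -> t <= T -> mder P t (ric A W S (P t))) ->
  X T = P T *m Y T.
Proof.
move=> T0 X0 Y0 dX dY cP dP.
pose L s := A - P s *m S; pose Z s := X s - P s *m Y s.
have dZ (s : R) : 0 < s -> s <= T -> mder Z s (L s *m Z s).
  move=> s0 sT; apply: mder_eq (mderB (dX s) (mderM (dP s s0 sT) (dY s))) _.
  by rewrite /L /Z /ric; mxring.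
(* P is continuous on the compact interval [0, T], from the right at 0 by hypothesis, so the
   coefficient L is bounded there. *)
have [B B0 LB] : exists2 B, 0 <= B & forall s : R, 0 < s -> s <= T ->
    forall i j, `|L s i j| <= B.
  have cL (s : R) : mcvg (nbhs s) P (P s) -> abs_sum (L r) @[r --> s] --> abs_sum (L s).
    move=> h; apply: cvg_abs_sum; apply: mcvgB; first exact: mcvg_cst.
    by apply: mcvgM => //; exact: mcvg_cst.
  have : {within `[0, T], continuous (fun s => abs_sum (L s))}.
    apply/continuous_within_itvP => //; split.
    - move=> s; rewrite in_itv /= => /andP[s0 /ltW sT].
      by apply: cL; exact: mder_cvg (dP s s0 sT).
    - apply: cvg_abs_sum; apply: mcvgB; first exact: mcvg_cst.
      by apply: mcvgM => //; exact: mcvg_cst.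
    - by apply: cvg_at_left_filter; apply: cL; exact: mder_cvg (dP T T0 _).
  move=> /(EVT_max (ltW T0))[c _ cmax]; exists (abs_sum (L c)).
    exact: abs_sum_ge0.
  move=> s s0 sT i j; apply: le_trans (cmax s _); last first.
    by rewrite in_itv /= sT ltW.
  by apply: le_trans (row_abs_sum _ i); rewrite (bigD1 j) //= lerDl sumr_ge0.
(* The squared Frobenius norm of Z starts at 0 and satisfies u' <= 2 n B u, so [gronwall] keeps it
   at 0. *)
pose u s := \sum_i \sum_j Z s i j ^+ 2.
have u_ge0 s : 0 <= u s.
  by apply: sumr_ge0 => i _; apply: sumr_ge0 => j _; exact: sqr_ge0.
have u0 : u 0 = 0.
  rewrite /u /Z X0 Y0 mulmx1 subrr; apply: big1 => i _; apply: big1 => j _.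
  by rewrite mxE expr0n.
pose Du s := \sum_i \sum_j 2 * (Z s i j * (L s *m Z s) i j).
have du (s : R) : 0 < s -> s <= T -> is_derive s 1 u (Du s).
  move=> s0 sT.
  apply: is_derive_bigsum => i; apply: is_derive_bigsum => j.
  have dZij := dZ s s0 sT i j.
  by apply: (is_derive_eq (is_deriveM dZij dZij)); rewrite /GRing.scale /=; ring.
have Du_le (s : R) : 0 < s -> s <= T -> Du s <= (2 * (n%:R * B)) * u s.
  move=> s0 sT; rewrite /Du /u exchange_big [in leRHS]exchange_big mulr_sumr.
  apply: ler_sum => j _ /=.
  pose z i := Z s i j; rewrite mulr_sumr.
  have e i : (L s *m Z s) i j = \sum_k L s i k * z k by rewrite mxE.
  apply: le_trans (_ : \sum_i \sum_k B * (z i ^+ 2 + z k ^+ 2) <= _).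
    apply: ler_sum => i _; rewrite e mulrA mulr_sumr; apply: ler_sum => k _.
    have := LB s s0 sT i k; rewrite ler_norml => /andP[l1 l2].
    (* The sum of the two products gives 2 L_ik z_i z_k <= B (z_i^2 + z_k^2) without a case split on
       signs. *)
    have h1 : 0 <= (B - L s i k) * (z i + z k) ^+ 2.
      by rewrite mulr_ge0 ?sqr_ge0 // subr_ge0.
    have h2 : 0 <= (B + L s i k) * (z i - z k) ^+ 2.
      by rewrite mulr_ge0 ?sqr_ge0 //; lra.
    by rewrite -/(z i); nra.
  pose z2 := \sum_k z k ^+ 2.
  have row i : \sum_k B * (z i ^+ 2 + z k ^+ 2) = n%:R * (B * z i ^+ 2) + B * z2.
    transitivity (\sum_(k < n) (B * z i ^+ 2 + B * z k ^+ 2)).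
      by apply: eq_bigr => k _; rewrite mulrDr.
    by rewrite big_split /= sumr_const card_ord -mulr_sumr mulr_natl.
  rewrite (eq_bigr _ (fun i _ => row i)) big_split /= sumr_const card_ord.
  rewrite -!mulr_sumr -/z2 -[_ *+ n]mulr_natl.
  by rewrite le_eqVlt; apply/orP; left; apply/eqP; ring.
have cu : u s @[s --> (0 : R)^'+] --> u 0.
  have cflow (V : R -> 'M[R]_n) D : mder V 0 D -> mcvg (0 : R)^'+ V (V 0).
    by move=> dV i j; apply: cvg_at_right_filter; exact: mder_cvg dV i j.
  have cZ : mcvg (0 : R)^'+ Z (Z 0).
    apply: mcvgB; first exact: cflow (dX 0).
    by apply: mcvgM => //; exact: cflow (dY 0).
  by apply: cvg_bigsum => i; apply: cvg_bigsum => j; apply: cvgM; exact: cZ.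
have uT : u T <= 0.
  have := @gronwall _ u (2 * (n%:R * B)) T T0 cu; rewrite u0 mulr0; apply.
  by move=> s s0 sT; exists (Du s); [exact: du | exact: Du_le].
have {}uT : u T = 0 by apply/eqP; rewrite eq_le uT u_ge0.
apply/eqP; rewrite -subr_eq0; apply/eqP/matrixP => i j; rewrite [RHS]mxE.
apply/eqP; rewrite -sqrf_eq0 -/(Z T); apply/eqP.
apply: (psumr_eq0P (P := xpredT) (F := fun j => Z T i j ^+ 2)) => //.
  by move=> k _; exact: sqr_ge0.
apply: (psumr_eq0P (P := xpredT) (F := fun i => \sum_j Z T i j ^+ 2)) => //.
by move=> k _; apply: sumr_ge0 => l _; exact: sqr_ge0.
Qed.
End HamiltonianFlow.

(** * Balls of the distance *)

Section SpectralNorm.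
Variable R : realType.

Lemma enormE n (x : 'cV[R]_n) : enorm x = Num.sqrt (bf 1%:M x x).
Proof. by rewrite bf1E; congr Num.sqrt; apply: eq_bigr => i _; rewrite expr2. Qed.

(** A crude bound: it serves only to show that the suprema are finite. *)
Lemma enorm_mulmx_le n (P : 'M[R]_n) b x : (forall i j, `|P i j| <= b) ->
  enorm x <= 1 -> enorm (P *m x) <= Num.sqrt (n%:R * (n%:R * b) ^+ 2).
Proof.
move=> Pb x1; rewrite /enorm ler_wsqrtr //; apply: sum_bound => i.
have xj j : `|x j 0| <= 1.
  apply: le_trans x1; rewrite -sqrtr_sqr ler_wsqrtr // (bigD1 j) //= lerDl.
  by apply: sumr_ge0 => k _; exact: sqr_ge0.
have h : `|(P *m x) i 0| <= n%:R * b.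
  apply: le_trans (mulmx_entry_le _ _ xj) _; rewrite mulr1.
  by apply: sum_bound => j.
by rewrite -[leLHS]ger0_norm ?sqr_ge0 // normrX lerXn2r ?nnegrE // (le_trans _ h).
Qed.

Lemma enorm_mulmx_ub n (P : 'M[R]_n) b : (forall i j, `|P i j| <= b) ->
  ubound [set enorm (P *m x) | x in [set x : 'cV[R]_n | enorm x <= 1]]
    (Num.sqrt (n%:R * (n%:R * b) ^+ 2)).
Proof. by move=> Pb _ [x /= x1 <-]; exact: enorm_mulmx_le. Qed.

Lemma enorm_mulmx_nonempty n (P : 'M[R]_n) :
  [set enorm (P *m x) | x in [set x : 'cV[R]_n | enorm x <= 1]] !=set0.
Proof.
exists (enorm (P *m 0)), 0 => //=.
by rewrite enormE /bf mulmx0 mxE sqrtr0.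
Qed.

Lemma spectral_norm_le n (P : 'M[R]_n) b : (forall i j, `|P i j| <= b) ->
  spectral_norm P <= Num.sqrt (n%:R * (n%:R * b) ^+ 2).
Proof.
by move=> Pb; apply: ge_sup; [exact: enorm_mulmx_nonempty | exact: enorm_mulmx_ub].
Qed.

Lemma bf_spectral_norm n (P : 'M[R]_n) x :
  bf P x x <= spectral_norm P * bf 1%:M x x.
Proof.
have [->|x0] := eqVneq x 0; first by rewrite /bf !mulmx0 mxE mulr0.
pose r := Num.sqrt (bf 1%:M x x).
have r0 : 0 < r by rewrite sqrtr_gt0 bf1_gt0.
have r2 : bf 1%:M x x = r ^+ 2 by rewrite sqr_sqrtr ?bf1_ge0.
pose y := r^-1 *: x.
have xy : x = r *: y by rewrite scalerA mulfV ?scale1r // gt_eqF.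
have y1 : bf 1%:M y y = 1 by rewrite bfZl bfZr r2; field; rewrite gt_eqF.
clearbody y.
have -> : bf P x x = r ^+ 2 * bf P y y by rewrite xy bfZl bfZr; ring.
rewrite r2 mulrC ler_pM2r ?exprn_gt0 //.
apply: le_trans (_ : enorm (P *m y) <= _).
  apply: le_trans (ler_norm _) _; rewrite -sqrtr_sqr enormE ler_wsqrtr //.
  set q := bf P y y.
  (* Cauchy-Schwarz for the unit vector y: this squared norm equals |P y|^2 - q^2. *)
  have := bf1_ge0 (P *m y - q *: y).
  rewrite -scaleN1r scalerA !(bfDl, bfDr, bfZl, bfZr) y1.
  rewrite (bf_sym (P := 1%:M) y _ (trmx1 _ _)) .
  have -> : bf 1%:M (P *m y) y = q.
    by rewrite bf_sym ?trmx1 // /q -bf_mulmx mul1mx.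
  by nra.
apply: ub_le_sup; last by exists y => //=; rewrite enormE y1 sqrtr1.
exists (Num.sqrt (n%:R * (n%:R * abs_sum P) ^+ 2)); apply: enorm_mulmx_ub => i j.
by apply: le_trans (row_abs_sum P i); rewrite (bigD1 j) //= lerDl sumr_ge0.
Qed.

Lemma spectral_norm_gt0 n (P : 'M[R]_n) : (0 < n)%N -> spd P ->
  0 < spectral_norm P.
Proof.
case: n P => // n P _ [_ P0].
have x0 : delta_mx 0 0 != 0 :> 'cV[R]_n.+1.
  by apply/eqP => /matrixP/(_ 0 0)/eqP; rewrite !mxE !eqxx oner_eq0.
have := lt_le_trans (P0 _ x0) (bf_spectral_norm P (delta_mx 0 0)).
by rewrite pmulr_lgt0 // bf1_gt0.
Qed.

(** The order bound P <= exp (r) Q controls the diagonal entries, and positivity controls the others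
    by the diagonal. *)
Lemma spd_ball_entry n (Q R0 P : 'M[R]_n) i j : spd Q -> spd_ball Q R0 P ->
  `|P i j| <= expR (spd_dist Q R0) * \tr Q.
Proof.
move=> Qpd [Ppd PQ].
have Qd k : 0 <= Q k k by rewrite -bf_delta spd_psd.
have le_exp : expR (Num.sqrt (sqdist Q P)) <= expR (spd_dist Q R0).
  by rewrite ler_expR -spd_distE.
have le_tr k : Q k k <= \tr Q.
  by rewrite /mxtrace (bigD1 k) //= lerDl sumr_ge0.
have Pd k : P k k <= expR (spd_dist Q R0) * \tr Q.
  rewrite -bf_delta; apply: le_trans (sqdist_bound Ppd Qpd _) _.
  by rewrite bf_delta (ler_pM (expR_ge0 _) (Qd k) le_exp (le_tr k)).
apply: le_trans (psd_entry i j (proj1 Ppd) (spd_psd Ppd)) _.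
by rewrite ler_pdivrMr // mulr_natr mulr2n (lerD (Pd i) (Pd j)).
Qed.

Lemma sup_norm_ball_lty n (Q R0 : 'M[R]_n) : spd Q ->
  (sup_norm_ball Q R0 < +oo)%E.
Proof.
move=> Qpd; pose b := expR (spd_dist Q R0) * \tr Q.
apply: (@le_lt_trans _ _ (Num.sqrt (n%:R * (n%:R * b) ^+ 2))%:E); last exact: ltry.
apply: ge_ereal_sup => _ [P PB <-]; rewrite lee_fin.
by apply: spectral_norm_le => i j; exact: spd_ball_entry PB.
Qed.

Lemma spectral_norm_ball_le n (Q R0 P : 'M[R]_n) : spd Q -> spd_ball Q R0 P ->
  spectral_norm P <= fine (sup_norm_ball Q R0).
Proof.
move=> Qpd PB.
have h : ((spectral_norm P)%:E <= sup_norm_ball Q R0)%E.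
  by apply: ereal_sup_ubound; exists P.
(* [fine] sends infinite values to 0, so finiteness is needed on both sides; P itself rules out the
   supremum -oo. *)
have fin : sup_norm_ball Q R0 \is a fin_num.
  rewrite fin_numE -ltey sup_norm_ball_lty // andbT.
  by apply/eqP => E; move: h; rewrite E leeNy_eq.
by rewrite -lee_fin fineK.
Qed.
End SpectralNorm.

(** * Global existence and invariant balls *)

Section GlobalSolution.
Variables (R : realType) (n : nat) (A W S : 'M[R]_n).
Hypotheses (Wpd : spd W) (Ss : S^T = S) (Sp : psd S).
Let Phi := ric A W S.

(** P agrees with X Y^-1 on [0, T[ by uniqueness, and X Y^-1 is a solution for all times, so
    maximality forces T = +oo. The symmetry and positivity of P(t) are read off X Y^-1. *)
Lemma maximal_solution_global (T : \bar R) (P : R -> 'M[R]_n) :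
  maximal_solution Phi T P -> spd (P 0) ->
  T = +oo%E /\ global_spd_solution A W S P.
Proof.
move=> [[T0 cP dP] maxP] P0pd.
have [X [Y [X0 Y0 dX dY]]] := hamiltonian_flow A W S (P 0).
have X0pd : spd (X 0) by rewrite X0.
have flow := hamiltonian_flow_spd Wpd Ss Sp X0pd Y0 dX dY.
pose P' t := X t *m invmx (Y t).
have dP' t : 0 <= t -> mder P' t (Phi (P' t)).
  by move=> /flow[Yu _]; exact: flow_riccati.
have P'0 : P' 0 = P 0 by rewrite /P' Y0 invmx1 mulmx1.
have cP0 : mcvg (0 : R)^'+ P (P 0).
  move=> i j.
  exact: (cvg_comp _ _ cP (@coord_continuous _ _ _ i j (P 0))).
have PE t : 0 <= t -> (t%:E < T)%E -> P' t = P t.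
  rewrite le_eqVlt => /predU1P[<- //|t0 tT].
  have [Yu _] := flow t (ltW t0).
  rewrite /P' (riccati_flow_unique t0 X0 Y0 dX dY cP0) ?mulmxK // => s s0 st.
  by apply/mderP; apply: dP => //; apply: le_lt_trans tT; rewrite lee_fin.
have solP' : solution Phi +oo P'.
  split => //; last by move=> t t0 _; apply/mderP/dP'/ltW.
  apply: cvg_at_right_filter.
  have /mderP[/derivable1_diffP/differentiable_continuous c _] := dP' 0 (lexx _).
  exact: c.
have TE : T = +oo%E by apply/eqP; rewrite -leye_eq (maxP _ _ solP').
split => //; split => //.
- by move=> t t0; rewrite -PE ?TE ?ltry //; have [] := flow t t0.
- by move=> t t0; apply/mderP; apply: dP => //; rewrite TE ltry.
Qed.

Lemma cst_solution (Q : 'M[R]_n) : Phi Q = 0 ->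
  maximal_solution Phi +oo%E (fun=> Q).
Proof.
move=> Q0; split; last by move=> T' P' _ _; exact: leey.
by split => // [|t _ _]; [exact: cvg_cst | rewrite Q0; exact: is_derive_cst].
Qed.

Lemma sqrt_decay (c t q : R) :
  Num.sqrt (expR (- (2 * c) * t) * q) = expR (- c * t) * Num.sqrt q.
Proof.
have -> : - (2 * c) * t = - c * t + - c * t by ring.
by rewrite expRD -expr2 sqrtrM ?sqr_ge0 // sqrtr_sqr ger0_norm // expR_ge0.
Qed.

Lemma spd_dist_contraction P1 P2 (c : R) :
    global_spd_solution A W S P1 -> global_spd_solution A W S P2 -> 0 <= c ->
    (forall t : R, 0 < t -> forall x, c * bf (P1 t) x x <= bf W x x) ->
    (forall t : R, 0 < t -> forall x, c * bf (P2 t) x x <= bf W x x) ->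
  forall t : R, 0 <= t ->
    spd_dist (P1 t) (P2 t) <= expR (- c * t) * spd_dist (P1 0) (P2 0).
Proof.
move=> s1 s2 c0 c1 c2 t t0; rewrite !spd_distE -sqrt_decay ler_wsqrtr //.
exact: (contraction Sp s1 s2 c0 c1 c2).
Qed.

(** Contraction towards the constant solution Q at rate c = 0, for which the comparison with W is
    trivial. Any positive c would require bounds on P(t) that are only known inside the ball. *)
Lemma spd_ball_invariant Q R0 P : spd Q -> global_spd_solution A W S P ->
    global_spd_solution A W S (fun=> Q) -> spd_ball Q R0 (P 0) ->
  forall t : R, 0 <= t -> spd_ball Q R0 (P t).
Proof.
move=> Qpd sP sQ [P0pd P0Q] t t0; have [_ sPt _] := sP.
split; first exact: sPt.
apply: le_trans P0Q.
rewrite (spd_dist_sym Qpd (sPt t t0)) (spd_dist_sym Qpd P0pd).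
have c0 (P' : R -> 'M[R]_n) (s : R) : 0 < s ->
    forall x, 0 * bf (P' s) x x <= bf W x x.
  by move=> _ x; rewrite mul0r; exact: spd_psd.
have := spd_dist_contraction sP sQ (lexx 0) (c0 P) (c0 (fun=> Q)) t0.
by rewrite oppr0 mul0r expR0 mul1r.
Qed.
End GlobalSolution.

(** * The stationary solution and the contraction estimate *)

Lemma riccatiE (R : realType) (n m p q : nat) (A : 'M[R]_n) (G : 'M[R]_(n, m))
    (C : 'M[R]_(p, n)) (H : 'M[R]_(p, q)) :
  riccati A G C H =
  ric A (G *m G^T) (C^T *m invmx (H *m H^T) *m C).
Proof. by apply/funext => P; rewrite /riccati /ric !mulmxA. Qed.

Unset Implicit Arguments.

Theorem proposition1 (R : realType) (n m p q : nat)
    (A : 'M[R]_n) (G : 'M[R]_(n, m)) (C : 'M[R]_(p, n)) (H : 'M[R]_(p, q))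
    (n_gt0 : (0 < n)%N)
    (A_unit : A \in unitmx)
    (HH_unit : H *m H^T \in unitmx)
    (AC_obs : observable A C)
    (GG_unit : G *m G^T \in unitmx) :
  let Phi := riccati A G C H in
  exists Q : 'M[R]_n,
    unique (fun P => spd P /\ Phi P = 0) Q /\
    (exists mu : R,
      [/\ lowest_eigenvalue (G *m G^T) mu, 0 < mu &
        forall R0 : 'M[R]_n, spd R0 ->
          (sup_norm_ball Q R0 < +oo)%E /\
          forall (T1 T2 : \bar R) (P1 P2 : R -> 'M[R]_n),
            maximal_solution Phi T1 P1 -> maximal_solution Phi T2 P2 ->
            spd_ball Q R0 (P1 0) -> spd_ball Q R0 (P2 0) ->
            [/\ T1 = +oo%E, T2 = +oo%E &
              forall t : R, 0 <= t ->
                [/\ spd_ball Q R0 (P1 t), spd_ball Q R0 (P2 t) &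
                  spd_dist (P1 t) (P2 t) <=
                    expR (- (mu / fine (sup_norm_ball Q R0)) * t) *
                    spd_dist (P1 0) (P2 0)]]]) /\
    (forall (T : \bar R) (P : R -> 'M[R]_n),
      maximal_solution Phi T P -> spd (P 0) ->
      [/\ T = +oo%E, forall t : R, 0 <= t -> spd (P t) &
        exists K c : R, 0 < c /\
          forall t : R, 0 <= t -> spd_dist (P t) Q <= K * expR (- c * t)]).
Proof.
move=> Phi; rewrite /Phi riccatiE => {Phi}.
set W := G *m G^T; set S := C^T *m _ *m C.
have Wpd : spd W by exact: spd_mulmxT.
have Zpd : spd (invmx (H *m H^T)) by apply: spd_inv; exact: spd_mulmxT.
have Ss : S^T = S by rewrite /S !trmx_mul trmxK (proj1 Zpd) mulmxA.
have Sp : psd S by apply: psd_congr; exact: spd_psd.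
have [X [Xs Xp X0]] := dual_riccati_solution A Wpd Ss Sp.
have Xpd : spd X by exact: (dual_riccati_spd Zpd AC_obs Xs Xp X0).
pose Q := invmx X; have Qpd : spd Q by exact: spd_inv.
have Q0 : ric A W S Q = 0 by apply: ric_invmx => //; exact: spd_unit.
have solQ := cst_solution Q0.
have [_ gQ] := maximal_solution_global Wpd Ss Sp solQ Qpd.
have [mu [mu_low mu0 muW]] := lowest_eigenvalue_spd n_gt0 Wpd.
have main R0 T1 T2 P1 P2 : spd R0 ->
    maximal_solution (ric A W S) T1 P1 -> maximal_solution (ric A W S) T2 P2 ->
    spd_ball Q R0 (P1 0) -> spd_ball Q R0 (P2 0) ->
    0 < fine (sup_norm_ball Q R0) /\
    [/\ T1 = +oo%E, T2 = +oo%E & forall t : R, 0 <= t ->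
      [/\ spd_ball Q R0 (P1 t), spd_ball Q R0 (P2 t) &
        spd_dist (P1 t) (P2 t) <=
          expR (- (mu / fine (sup_norm_ball Q R0)) * t) *
            spd_dist (P1 0) (P2 0)]].
  move=> R0pd m1 m2 b1 b2.
  have [T1E g1] := maximal_solution_global Wpd Ss Sp m1 (proj1 b1).
  have [T2E g2] := maximal_solution_global Wpd Ss Sp m2 (proj1 b2).
  set M := fine _.
  (* R0 lies in its own ball and has positive norm because n > 0. *)
  have M0 : 0 < M.
    apply: lt_le_trans (spectral_norm_gt0 n_gt0 R0pd) _.
    exact: (spectral_norm_ball_le Qpd (conj R0pd (lexx _))).
  (* On the ball, (mu / M) P <= mu <= W, as P is at most its spectral norm times the identity. This
     is the origin of the rate. *)
  have cB P x : spd_ball Q R0 P -> mu / M * bf P x x <= bf W x x.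
    move=> PB; apply: le_trans (muW x).
    rewrite -mulrA ler_pM2l // ler_pdivrMl //.
    apply: le_trans (bf_spectral_norm P x) _; rewrite ler_wpM2r ?bf1_ge0 //.
    exact: (spectral_norm_ball_le Qpd PB).
  have B1 := spd_ball_invariant Wpd Sp Qpd g1 gQ b1.
  have B2 := spd_ball_invariant Wpd Sp Qpd g2 gQ b2.
  split; first exact: M0.
  split; [exact: T1E | exact: T2E | move=> t t0].
  split; [exact: (B1 t t0) | exact: (B2 t t0) |].
  have muM : 0 <= mu / M by rewrite divr_ge0 // ltW.
  apply: (spd_dist_contraction Sp g1 g2 muM _ _ t0) => s /ltW s0 x.
    exact: (cB _ _ (B1 s s0)).
  exact: (cB _ _ (B2 s s0)).
exists Q; split; [|split].
- split => // P [Ppd P0]; exact: (ric_unique Wpd Sp Qpd Ppd Q0 P0).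
- exists mu; split; [exact: mu_low | exact: mu0 | move=> R0 R0pd].
  split; first exact: (sup_norm_ball_lty R0 Qpd).
  move=> T1 T2 P1 P2 m1 m2 b1 b2.
  exact: (proj2 (main R0 T1 T2 P1 P2 R0pd m1 m2 b1 b2)).
- move=> T P mP P0pd.
  (* The ball whose radius is the initial distance contains both P(0) and the centre Q, so the
     estimate applies to P and the constant solution. *)
  have bP : spd_ball Q (P 0) (P 0) := conj P0pd (lexx _).
  have bQ : spd_ball Q (P 0) Q.
    split; first exact: Qpd.
    by rewrite spd_dist_refl // spd_distE sqrtr_ge0.
  have [M0 [TE _ dec]] := main (P 0) T +oo%E P (fun=> Q) P0pd mP solQ bP bQ.
  split; [exact: TE | by move=> t t0; have [[]] := dec t t0 |].
  exists (spd_dist (P 0) Q), (mu / fine (sup_norm_ball Q (P 0))).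
  split; first exact: (divr_gt0 mu0 M0).
  by move=> t t0; have [_ _] := dec t t0; rewrite mulrC.
Qed.
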